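(* Let $E\to M$ be a symplectic vector bundle over a smooth manifold $M$, let $\pi:L(E)\to M$ be its Lagrange Grassmannian bundle, and let $E'=\pi^*E\to L(E)$ be the pullback symplectic vector bundle. If $X$ and $Y$ are sections of $L(E)\to M$, and $X'$, $Y'$ are the lifted sections of the bundle $L(E')\to L(E)$, then $$\sigma(E';X',Y')=\pi^*\sigma(E;X,Y)\in\check{H}^1(L(E);\mathbb{Z}).$$
   Context: A symplectic vector bundle $E\to M$ is a vector bundle with a symplectic form $\omega_m$ on each fibre $E_m$ depending smoothly on $m$. $L(E)\to M$ is the bundle whose fibre over $m$ is $L(E_m)$, the Lagrange Grassmannian of all Lagrangian planes of $(E_m,\omega_m)$. Lifted sections: for $x\in L(E)_m$ the fibre $E'_x$ is identified with $E_m$, so $L(E')_x$ is identified with $L(E)_m$. For a section $S:M\to L(E)$, the lifted section $S':L(E)\to L(E')$ is $S'(x)=S(m)$ for $x\in L(E)_m$. Hörmander index: let $X,Y,Z,W$ be Lagrangian planes in a symplectic vector space $(V,\omega)$ with $Z\cap X=Z\cap Y=\{0\}$ and $W\cap X=W\cap Y=\{0\}$. Define nondegenerate quadratic forms on $Y/(X\cap Y)$ by $Q_Z(y)=\omega(p_Z^X y,y)$ and $Q_W(y)=\omega(p_W^X y,y)$, where $p_Z^X$ and $p_W^X$ are the projections onto $Z$ and $W$, respectively, along $X$. Put $$(X,Y,Z,W)=\tfrac12(\operatorname{sign}Q_Z-\operatorname{sign}Q_W)=\operatorname{ind}Q_W-\operatorname{ind}Q_Z ,$$ where $\operatorname{sign}$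 is the signature and $\operatorname{ind}$ is the number of negative squares. Hörmander class: let $X,Y$ be sections of $L(E)\to M$. Choose a good open covering $\{U_\alpha\}$ of $M$ (all nonempty finite intersections diffeomorphic to a Euclidean space), fine enough that there are sections $Z_\alpha$ of $L(E)$ over $U_\alpha$ with $Z_\alpha(m)$ transversal to $X(m)$ and $Y(m)$ for all $m$. The formula $\sigma(U_\alpha,U_\beta)=(X,Y,Z_\alpha,Z_\beta)$ (evaluated at points of $U_\alpha\cap U_\beta$) defines a Čech 1-cocycle, whose class, independent of the choices, is $\sigma(E;X,Y)\in\check H^1(M;\mathbb{Z})$. *)

(* Defs.v *)
From HB Require Import structures.
From mathcomp Require Import all_boot all_order all_algebra.
From mathcomp Require Import generic_quotient zify.
From mathcomp Require Import boolp classical_sets reals topology normedtype derive.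

Set Implicit Arguments.
Unset Strict Implicit.
Unset Printing Implicit Defensive.

Import Order.TTheory GRing.Theory Num.Theory.
Import numFieldNormedType.Exports.

Local Open Scope classical_set_scope.
Local Open Scope ring_scope.

Section SmoothEuclidean.
Context {R : realType} {V W : normedModType R}.

Fixpoint Ck (k : nat) (O : set V) (g : V -> W) : Prop :=
  if k is k'.+1 then
    forall v : V, (forall x, O x -> derivable g x v) /\ Ck k' O ('D_v g)
  else forall x, O x -> {for x, continuous g}.

(* Meant for open [O]; the values of [g] outside [O] are then irrelevant. *)
Definition Cinfty (O : set V) (g : V -> W) := forall k, Ck k O g.

End SmoothEuclidean.

(* A set with a family of R^d-valued charts, without the manifold axioms, which
   are the predicate [smooth_manifold] below.  Chart [i] is the restriction of
   [coord i] to [dom i]. *)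
Record atlas (R : realType) := Atlas {
  points : Type;
  dim : nat;
  chart : Type;
  dom : chart -> set points;
  coord : chart -> points -> 'rV[R]_dim }.

Definition space (R : realType) (M : atlas R) : Type := points M.
Coercion space : atlas >-> Sortclass.

Definition chart_opens (R : realType) (M : atlas R) : set (set M) :=
  [set U | exists (i : chart M) (O : set 'rV[R]_(dim M)),
     open O /\ U = dom i `&` coord i @^-1` O].

(* The topology of [M] is the coarsest one making chart domains open and charts
   continuous; for a smooth manifold the charts are then homeomorphisms onto open
   subsets of R^d. *)
HB.instance Definition _ (R : realType) (M : atlas R) := gen_eqMixin (space M).
HB.instance Definition _ (R : realType) (M : atlas R) :=
  gen_choiceMixin (space M).
HB.instance Definition _ (R : realType) (M : atlas R) :=
  isSubBaseTopological.Build (space M) (@chart_opens R M) id.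

Section Manifolds.
Context {R : realType}.

Record smooth_manifold (M : atlas R) : Prop := SmoothManifold {
  charts_cover : forall x : M, exists i : chart M, dom i x;
  chart_inj : forall (i : chart M) (x y : M),
    dom i x -> dom i y -> coord i x = coord i y -> x = y;
  overlap_open : forall i j : chart M, open (coord i @` (dom i `&` dom j));
  transition_smooth : forall i j : chart M,
    exists2 g : 'rV[R]_(dim M) -> 'rV[R]_(dim M),
      Cinfty (coord i @` (dom i `&` dom j)) g &
      forall x : M, dom i x -> dom j x -> coord j x = g (coord i x);
  manifold_hausdorff : hausdorff_space M;
  manifold_second_countable : @second_countable M }.

(* The restriction of [f] to the open set [A] is smooth. *)
Definition smooth_on (M N : atlas R) (A : set M) (f : M -> N) : Prop :=
  forall x, A x -> exists (i : chart M) (j : chart N) (U : set M),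
    [/\ open U, U x, U `<=` A `&` dom i, U `<=` f @^-1` dom j &
      exists2 g : 'rV[R]_(dim M) -> 'rV[R]_(dim N),
        Cinfty (coord i @` U) g &
        forall y, U y -> coord j (f y) = g (coord i y)].

Definition euclid (d : nat) : atlas R :=
  @Atlas R 'rV[R]_d d unit (fun=> setT) (fun=> id).

Definition diffeo_euclid (M : atlas R) (A : set M) : Prop :=
  exists (f : M -> euclid (dim M)) (g : euclid (dim M) -> M),
    [/\ smooth_on A f, smooth_on setT g,
        forall v, A (g v) /\ f (g v) = v & forall x, A x -> g (f x) = x].

Definition good_cover (M : atlas R) (I : Type) (U : I -> set M) : Prop :=
  [/\ forall i, open (U i), forall x, exists i, U i x &
      forall (k : nat) (s : 'I_k.+1 -> I),
        (\bigcap_l U (s l)) !=set0 -> diffeo_euclid (\bigcap_l U (s l))].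

End Manifolds.

Section SymplecticLinear.
Context {R : realType} {V : vectType R}.

Record symplectic_form (w : V -> V -> R) : Prop := SymplecticForm {
  form_linear_r : forall u, scalar (w u);
  form_linear_l : forall v, scalar (w^~ v);
  form_alternating : forall v, w v v = 0;
  form_nondegenerate : forall u, (forall v, w u v = 0) -> u = 0 }.

Record lagrangian (w : V -> V -> R) := Lagrangian {
  plane :> {vspace V};
  plane_isotropic : forall u v, u \in plane -> v \in plane -> w u v = 0;
  plane_dim : (\dim plane).*2 = \dim {:V} }.

Definition transverse (A B : {vspace V}) : Prop := (A :&: B)%VS = 0%VS.

(* [Q] is a quadratic form on [Y] that descends to [Y / K].  The classes of the
   entries of [e] form a basis of [Y / K] in which [Q] is the combination of
   squares with coefficients [c]. *)
Definition diagonal_basis (Q : V -> R) (Y K : {vspace V}) (r : nat)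
    (e : r.-tuple V) (c : 'I_r -> R) : Prop :=
  [/\ free e, (K :&: <<e>> = 0)%VS, (K + <<e>> = Y)%VS &
      forall (t : 'I_r -> R) (k : V), k \in K ->
        Q (\sum_i t i *: e`_i + k) = \sum_i c i * t i ^+ 2].

(* The number of negative squares of [Q] on [Y / K], which by Sylvester's law of
   inertia depends on no choice. *)
Definition ind (Q : V -> R) (Y K : {vspace V}) : nat :=
  xget 0%N [set m | exists (r : nat) (e : r.-tuple V) (c : 'I_r -> R),
    diagonal_basis Q Y K e c /\ m = #|[pred i | c i < 0]|].

(* [daddv_pi Z X] is the projection onto [Z] along [X]. *)
Definition hform (w : V -> V -> R) (X Z : {vspace V}) (y : V) : R :=
  w (daddv_pi Z X y) y.

(* Half the difference of the signatures of Q_Z and Q_W: both forms are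
   nondegenerate on [Y / (X :&: Y)] when Z and W are transversal to X and Y. *)
Definition hormander_index (w : V -> V -> R) (X Y Z W : {vspace V}) : int :=
  (ind (hform w X W) Y (X :&: Y))%:Z - (ind (hform w X Z) Y (X :&: Y))%:Z.

End SymplecticLinear.

Section Bundles.
Context {R : realType}.

(* Fibres with a form, and a family of fibrewise maps to R^{2n}; the axioms are
   [symplectic_bundle].  Trivialization [i] is the restriction of [triv i] to the
   fibres over [triv_dom i]. *)
Record bundle (M : atlas R) (n : nat) := Bundle {
  fib : M -> vectType R;
  form : forall m, fib m -> fib m -> R;
  triv_idx : Type;
  triv_dom : triv_idx -> set M;
  triv : triv_idx -> forall m, fib m -> 'rV[R]_(n + n) }.

Definition smooth_mx (M : atlas R) (A : set M) (p q : nat)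
    (g : M -> 'M[R]_(p, q)) : Prop :=
  smooth_on A (fun m => mxvec (g m) : euclid (p * q)).

Record symplectic_bundle (M : atlas R) (n : nat) (E : bundle M n) : Prop :=
  SymplecticBundle {
  triv_open : forall i : triv_idx E, open (triv_dom i);
  triv_cover : forall m : M, exists i : triv_idx E, triv_dom i m;
  triv_iso : forall (i : triv_idx E) (m : M), triv_dom i m ->
    linear (triv i (m := m)) /\ bijective (triv i (m := m));
  triv_change : forall i j : triv_idx E,
    exists2 g : M -> 'M[R]_(n + n),
      smooth_mx (triv_dom i `&` triv_dom j) g &
      forall m (v : fib E m), triv_dom i m -> triv_dom j m ->
        triv j v = triv i v *m g m;
  fibre_symplectic : forall m : M, symplectic_form (@form M n E m);
  form_smooth : forall i : triv_idx E,
    exists2 g : M -> 'M[R]_(n + n),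
      smooth_mx (triv_dom i) g &
      forall m (u v : fib E m), triv_dom i m ->
        form u v = (triv i u *m g m *m (triv i v)^T) 0 0 }.

Definition pullback (N M : atlas R) (n : nat) (f : N -> M) (E : bundle M n) :
    bundle N n :=
  {| fib := fun x => fib E (f x);
     form := fun x => @form M n E (f x);
     triv_dom := fun i : triv_idx E => f @^-1` triv_dom i;
     triv := fun i x => @triv M n E i (f x) |}.

End Bundles.

Section LagrangeGrassmannian.
Context {R : realType}.

Definition lag (M : atlas R) (n : nat) (E : bundle M n) (m : M) : Type :=
  lagrangian (@form R M n E m).

(* A smooth family of symplectic bases (e_1, .., e_n, f_1, .., f_n) of the
   fibres over an open set. *)
Record frame (M : atlas R) (n : nat) (E : bundle M n) := Frame {
  fr_dom : set M;
  fr_e : forall m, 'I_n -> fib E m;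
  fr_f : forall m, 'I_n -> fib E m;
  fr_open : open fr_dom;
  fr_e_smooth : forall k (i : triv_idx E),
    smooth_mx (fr_dom `&` triv_dom i) (fun m => triv i (fr_e m k));
  fr_f_smooth : forall k (i : triv_idx E),
    smooth_mx (fr_dom `&` triv_dom i) (fun m => triv i (fr_f m k));
  fr_ee : forall m j k, fr_dom m -> form (fr_e m j) (fr_e m k) = 0;
  fr_ff : forall m j k, fr_dom m -> form (fr_f m j) (fr_f m k) = 0;
  fr_ef : forall m j k, fr_dom m ->
    form (fr_e m j) (fr_f m k) = (j == k)%:R }.

Definition fr_span (M : atlas R) (n : nat) (E : bundle M n) (F : frame E)
    (m : M) : {vspace fib E m} := <<[seq fr_f F m k | k : 'I_n]>>%VS.

(* A Lagrangian plane transversal to F = <f_1, .., f_n> has a unique basis of the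
   form e_j + \sum_k S_jk f_k, with S symmetric.  As this basis is the image of
   (e_1, .., e_n) under the projection onto the plane along F, the coefficient
   S_jk is the pairing below. *)
Definition lag_mx (M : atlas R) (n : nat) (E : bundle M n) (F : frame E)
    (m : M) (L : lag E m) : 'M[R]_n :=
  \matrix_(j, k)
    form (fr_e F m k) (daddv_pi (plane L) (fr_span F m) (fr_e F m j)).

Definition upper_entry (n : nat) : pred ('I_n * 'I_n) :=
  [pred p : 'I_n * 'I_n | (p.1 <= p.2)%N].
Arguments upper_entry : clear implicits.

Definition upper (n : nat) (S : 'M[R]_n) : 'rV[R]_#|upper_entry n| :=
  \row_k S (enum_val k).1 (enum_val k).2.

(* L(E), with the charts given by a chart of M and a symplectic frame. *)
Definition LG (M : atlas R) (n : nat) (E : bundle M n) : atlas R :=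
  {| points := {m : M & lag E m};
     dim := (dim M + #|upper_entry n|)%N;
     chart := chart M * frame E;
     dom := fun c => [set x | [/\ dom c.1 (projT1 x), fr_dom c.2 (projT1 x) &
       transverse (plane (projT2 x)) (fr_span c.2 (projT1 x))]];
     coord := fun c x =>
       row_mx (coord c.1 (projT1 x)) (upper (lag_mx c.2 (projT2 x))) |}.

Definition LG_proj (M : atlas R) (n : nat) (E : bundle M n) (x : LG E) : M :=
  projT1 x.

(* Smooth sections over the open set [A] of L(E); values outside [A] are
   irrelevant, and every fibre of L(E) is nonempty. *)
Definition smooth_section (M : atlas R) (n : nat) (E : bundle M n) (A : set M)
    (S : forall m, lag E m) : Prop :=
  smooth_on A (fun m => existT (lag E) m (S m) : LG E).

Definition LG_bundle (M : atlas R) (n : nat) (E : bundle M n) :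
    bundle (LG E) n := pullback (@LG_proj M n E) E.

Definition lifted_section (M : atlas R) (n : nat) (E : bundle M n)
    (S : forall m, lag E m) : forall x, lag (LG_bundle E) x :=
  fun x => S (LG_proj x).

End LagrangeGrassmannian.

(* A 1-cocycle, with values in the sheaf of locally constant integer functions,
   of some open covering. *)
Record cocycle (T : topologicalType) := Cocycle {
  cidx : Type;
  cov : cidx -> set T;
  cval : cidx -> cidx -> T -> int;
  cov_open : forall i, open (cov i);
  cov_cover : forall x, exists i, cov i x;
  cval_locally_cst : forall i j x, cov i x -> cov j x ->
    \forall y \near x, cval i j y = cval i j x;
  cval_cocycle : forall i j k x, cov i x -> cov j x -> cov k x ->
    cval i j x + cval j k x = cval i k x }.

(* [c] and [d] become cohomologous on a common refinement of their coverings. *)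
Definition cohomologous (T : topologicalType) (c d : cocycle T) : Prop :=
  exists (I : Type) (U : I -> set T) (a : I -> cidx c) (b : I -> cidx d)
         (h : I -> T -> int),
  [/\ (forall i, open (U i)) /\ (forall x, exists i, U i x),
      forall i, U i `<=` cov (a i) `&` cov (b i),
      forall i x, U i x -> \forall y \near x, h i y = h i x &
      forall i j x, U i x -> U j x ->
        cval (b i) (b j) x - cval (a i) (a j) x = h j x - h i x].

Lemma cohomologous_refl (T : topologicalType) (c : cocycle T) :
  cohomologous c c.
Proof.
exists (cidx c), (@cov T c), id, id, (fun _ _ => 0); split.
- by split; [exact: cov_open | exact: cov_cover].
- by move=> i x.
- by move=> i x _; exact: nearW.
- by move=> i j x _ _; rewrite !subrr.
Qed.

Lemma cohomologous_sym (T : topologicalType) (c d : cocycle T) :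
  cohomologous c d -> cohomologous d c.
Proof.
move=> [I [U [a [b [h [HU Uab hc hE]]]]]].
exists I, U, b, a, (fun i x => - h i x); split => //.
- by move=> i x Ux; split; case: (Uab i x Ux).
- by move=> i x Ux; near=> y; congr (- _); near: y; exact: hc.
- by move=> i j x Ui Uj; rewrite -opprB hE// opprB opprK addrC.
Unshelve. all: by end_near. Qed.

Lemma cohomologous_trans (T : topologicalType) (c d e : cocycle T) :
  cohomologous c d -> cohomologous d e -> cohomologous c e.
Proof.
move=> [I [U [a [b [h [[Uo Uc] Uab hc hE]]]]]].
move=> [J [V [a' [b' [g [[Vo Vc] Vab gc gE]]]]]].
exists (I * J)%type, (fun p => U p.1 `&` V p.2), (a \o fst), (b' \o snd).
exists (fun p x => h p.1 x + cval (b p.1) (a' p.2) x + g p.2 x); split.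
- split=> [[i j]|x]; first exact: openI.
  by have [i Ui] := Uc x; have [j Vj] := Vc x; exists (i, j).
- by move=> [i j] x [/= /Uab[ca _] /Vab[_ cb]].
- move=> [i j] x [/= Ui Vj]; have [_ db] := Uab _ _ Ui.
  have [da _] := Vab _ _ Vj; near=> y.
  congr (_ + _ + _); near: y; [exact: hc|exact: cval_locally_cst|exact: gc].
- move=> [i j] [i' j'] x [/= Ui Vj] [/= Ui' Vj'].
  have [_ bi] := Uab _ _ Ui; have [_ bi'] := Uab _ _ Ui'.
  have [aj _] := Vab _ _ Vj; have [aj' _] := Vab _ _ Vj'.
  have h1 := hE _ _ _ Ui Ui'; have g1 := gE _ _ _ Vj Vj'.
  have e1 := cval_cocycle bi bi' aj'; have e2 := cval_cocycle bi aj aj'.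
  have -> : cval (b' j) (b' j') x =
    g j' x - g j x + cval (a' j) (a' j') x by rewrite -g1 subrK.
  have -> : cval (a i) (a i') x =
    cval (b i) (b i') x - (h i' x - h i x) by rewrite -h1 subKr.
  have -> : cval (b i) (b i') x =
    cval (b i) (a' j) x + cval (a' j) (a' j') x - cval (b i') (a' j') x
    by rewrite e2 -e1 addrK.
  set A := cval _ _ _; set B := cval _ _ _; set C := cval _ _ _.
  lia.
Unshelve. all: by end_near. Qed.

Section Cech.
Context (T : topologicalType).

HB.instance Definition _ := gen_eqMixin (cocycle T).
HB.instance Definition _ := gen_choiceMixin (cocycle T).

Definition cohomologousb (c d : cocycle T) : bool := `[< cohomologous c d >].

Lemma cohomologousb_refl : reflexive cohomologousb.
Proof. by move=> c; apply/asboolP; exact: cohomologous_refl. Qed.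

Lemma cohomologousb_sym : symmetric cohomologousb.
Proof.
by move=> c d; apply/asboolP/asboolP; exact: cohomologous_sym.
Qed.

Lemma cohomologousb_trans : transitive cohomologousb.
Proof.
move=> d c e /asboolP cd /asboolP de; apply/asboolP.
exact: cohomologous_trans de.
Qed.

Canonical cohomologous_equiv :=
  EquivRel cohomologousb cohomologousb_refl cohomologousb_sym
    cohomologousb_trans.

Definition cechH1 : Type := {eq_quot cohomologous_equiv}%qT.

Definition cech_class (c : cocycle T) : cechH1 :=
  (\pi_({eq_quot cohomologous_equiv}) c)%qT.

Lemma cech_classP (c d : cocycle T) :
  cech_class c = cech_class d <-> cohomologous c d.
Proof.
split; first by move=> /eqmodP/asboolP.
by move=> cd; apply/eqmodP/asboolP.
Qed.

End Cech.

Section CechPullback.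
Context (S T : topologicalType) (f : S -> T) (fc : continuous f).

Lemma pull_open (c : cocycle T) i : open (f @^-1` cov (c := c) i).
Proof. by move/continuousP: fc; apply; exact: cov_open. Qed.

Lemma pull_locally_cst (c : cocycle T) (i j : cidx c) (x : S) :
  cov i (f x) -> cov j (f x) ->
  \forall y \near x, cval i j (f y) = cval i j (f x).
Proof. by move=> ci cj; exact: (fc (cval_locally_cst ci cj)). Qed.

Definition pull_cocycle (c : cocycle T) : cocycle S :=
  {| cov_open := pull_open (c := c);
     cov_cover := fun x => cov_cover c (f x);
     cval_locally_cst := pull_locally_cst (c := c);
     cval_cocycle := fun i j k x => @cval_cocycle T c i j k (f x) |}.

Definition cech_pull (a : cechH1 T) : cechH1 S :=
  cech_class (pull_cocycle (repr a)).

Lemma cech_pullE (c : cocycle T) :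
  cech_pull (cech_class c) = cech_class (pull_cocycle c).
Proof.
apply/cech_classP; have /cech_classP : cech_class (repr (cech_class c)) =
  cech_class c by exact: reprK.
move=> [I [U [a [b [h [[Uo Uc] Uab hc hE]]]]]].
exists I, (fun i => f @^-1` U i), a, b, (fun i => h i \o f); split.
- split=> [i|x]; last exact: Uc.
  by move/continuousP: fc; apply.
- by move=> i x; exact: Uab.
- by move=> i x Ux; exact: (fc (hc _ _ Ux)).
- by move=> i j x; exact: hE.
Qed.

End CechPullback.

(* [s] is the class sigma(E; X, Y) computed from some admissible choice of a good
   covering (the one underlying [c]) and of local sections [Z]. *)
Definition is_hormander_class (R : realType) (M : atlas R) (n : nat)
    (E : bundle M n) (X Y : forall m, lag E m) (s : cechH1 M) : Prop :=
  exists (c : cocycle M) (Z : cidx c -> forall m, lag E m),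
    [/\ good_cover (@cov _ c),
        forall a, smooth_section (cov a) (Z a),
        forall a m, cov a m ->
          transverse (Z a m) (X m) /\ transverse (Z a m) (Y m),
        forall a b m, cov a m -> cov b m ->
          cval a b m =
            hormander_index (@form R M n E m) (X m) (Y m) (Z a m) (Z b m) &
        s = cech_class c].

(* Main.v *)
(* On the common refinement by the sets U'_a' `&` pi^-1 U_a, the lifted cocycle
   and the pulled back one differ by the coboundary of
     h x = (X, Y, Z'_a' x, Z_a (pi x)),
   because (X, Y, Z, W) is ind Q_W - ind Q_Z.  The point is that h is locally
   constant although ind Q_Z and ind Q_W jump with the dimension of the
   intersection of X and Y.  A linear change of variables shows that Q_W plus some
   nondegenerate form is congruent to Q_Z plus another nondegenerate form, where
   both nondegenerate forms are polynomial in the values of the symplectic form on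
   bases of X, Y, Z and W.  By Sylvester's law the Hormander index is thus a
   difference of indices of continuous families of nondegenerate forms.

   Continuity of pi needs a chart of L(E) at every point, that is, a symplectic
   frame transversal to a given Lagrangian plane L.  Smoothness of X provides some
   frame (e, f), and L is transversal to one of the 2^n coordinate planes spanned
   by f_j for j in J and e_j for j not in J. *)

From HB Require Import structures.
Require Import Defs.
From mathcomp Require Import all_boot all_order all_algebra.
From mathcomp Require Import boolp classical_sets reals topology normedtype derive.
From mathcomp Require Import ring lra zify.

Set Implicit Arguments.
Unset Strict Implicit.
Unset Printing Implicit Defensive.

Import Order.TTheory GRing.Theory Num.Theory.
Import numFieldNormedType.Exports.

Local Open Scope classical_set_scope.
Local Open Scope ring_scope.

(** * Index of a quadratic form *)

Section ScalarFunctions.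
Context {R : realType} {U : vectType R} (f : U -> R).
Hypothesis fl : scalar f.

Lemma linformD u v : f (u + v) = f u + f v.
Proof. by have := fl 1 u v; rewrite scale1r mul1r. Qed.

Lemma linform0 : f 0 = 0.
Proof. by apply: (addrI (f 0)); rewrite -linformD !addr0. Qed.

Lemma linformZ a u : f (a *: u) = a * f u.
Proof. by have := fl a u 0; rewrite linform0 !addr0. Qed.

Lemma linformN u : f (- u) = - f u.
Proof. by rewrite -scaleN1r linformZ mulN1r. Qed.

Lemma linform_sum (I : Type) (r : seq I) (P : pred I) (v : I -> U) :
  f (\sum_(i <- r | P i) v i) = \sum_(i <- r | P i) f (v i).
Proof. exact: (big_morph f linformD linform0). Qed.

Lemma linform_lfun : exists g : 'Hom(U, R^o), forall u, g u = f u.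
Proof.
pose h : {linear U -> R^o} := HB.pack f (GRing.isLinear.Build _ _ _ _ f fl).
by exists (linfun h) => u; rewrite lfunE.
Qed.

End ScalarFunctions.

(** * Bilinear forms and orthogonal bases *)

Section Bilinear.
Context {R : realType} {U : vectType R}.

Definition bilin (B : U -> U -> R) : Prop :=
  (forall u, scalar (B u)) /\ (forall v, scalar (B^~ v)).

Variables (B : U -> U -> R).
Hypothesis Bb : bilin B.

Lemma bilDr u v w : B u (v + w) = B u v + B u w.
Proof. exact: (linformD (Bb.1 u)). Qed.
Lemma bilDl u v w : B (u + v) w = B u w + B v w.
Proof. exact: (linformD (Bb.2 w)). Qed.
Lemma bil0r u : B u 0 = 0.
Proof. exact: (linform0 (Bb.1 u)). Qed.
Lemma bil0l u : B 0 u = 0.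
Proof. exact: (linform0 (Bb.2 u)). Qed.
Lemma bilNr u v : B u (- v) = - B u v.
Proof. exact: (linformN (Bb.1 u)). Qed.
Lemma bilNl u v : B (- u) v = - B u v.
Proof. exact: (linformN (Bb.2 v)). Qed.
Lemma bilZr a u v : B u (a *: v) = a * B u v.
Proof. exact: (linformZ (Bb.1 u)). Qed.
Lemma bilZl a u v : B (a *: u) v = a * B u v.
Proof. exact: (linformZ (Bb.2 v)). Qed.
Lemma bil_suml (I : Type) (r : seq I) (P : pred I) (v : I -> U) w :
  B (\sum_(i <- r | P i) v i) w = \sum_(i <- r | P i) B (v i) w.
Proof. exact: (linform_sum (Bb.2 w)). Qed.
Lemma bil_sumr (I : Type) (r : seq I) (P : pred I) (v : I -> U) w :
  B w (\sum_(i <- r | P i) v i) = \sum_(i <- r | P i) B w (v i).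
Proof. exact: (linform_sum (Bb.1 w)). Qed.

(** Induction on the dimension. A vector [v] of [Y] with [B v v] nonzero splits off: [Y] is the sum
    of its line and of the kernel of [B v] in [Y]. When there is no such vector, polarization makes
    [B] vanish on [Y], and any basis will do. *)
Lemma orthogonal_basis (Y : {vspace U}) :
  {in Y &, forall u v, B u v = B v u} ->
  exists2 e : seq U, basis_of Y e & forall i j, i != j -> B e`_i e`_j = 0.
Proof.
have [d] := ubnP (\dim Y); elim: d Y => // d IH Y; rewrite ltnS => dY Bs.
have [[v [vY Bvv]]|noiso] := pselect (exists v, v \in Y /\ B v v != 0); last first.
  have isoY u : u \in Y -> B u u = 0.
    by move=> uY; apply/eqP/negP => /negP Bu; apply: noiso; exists u.
  exists (vbasis Y); first exact: vbasisP.
  have memY i : (vbasis Y)`_i \in Y.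
    have [lt|ge] := ltnP i (size (vbasis Y)); first by rewrite vbasis_mem ?mem_nth.
    by rewrite nth_default ?mem0v.
  move=> i j _; set a := _`_i; set b := _`_j.
  have aY : a \in Y by exact: memY.
  have bY : b \in Y by exact: memY.
  have := isoY _ (memvD aY bY); rewrite bilDl !bilDr !isoY// (Bs b a)// add0r addr0.
  by lra.
have [g gE] := linform_lfun (Bb.1 v).
pose Y' := (Y :&: lker g)%VS.
have vY' : v \notin Y' by rewrite memv_cap memv_ker gE (negPf Bvv) andbF.
have defY : (<[v]> + Y')%VS = Y.
  apply/eqP; rewrite eqEsubv subv_add -memvE vY capvSl /=.
  apply/subvP => u uY; apply/memv_addP; exists ((B v u / B v v) *: v).
    by rewrite memvZ ?memv_line.
  exists (u - (B v u / B v v) *: v); last by rewrite addrC subrK.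
  rewrite memv_cap memvB ?memvZ//= memv_ker gE bilDr bilNr bilZr.
  by rewrite divfK ?subrr.
have dis : (<[v]> :&: Y' = 0)%VS.
  apply/eqP; rewrite -subv0; apply/subvP => u /memv_capP[/vlineP[k ->] kY].
  rewrite memv0; have [->|k0] := eqVneq k 0; first by rewrite scale0r.
  case/negP: vY'; have := memvZ k^-1 kY; by rewrite scalerA mulVf ?scale1r.
have v0 : v != 0 by apply: contraNneq Bvv => ->; rewrite bil0l.
have dY' : (\dim Y' < d)%N.
  by move: dY; rewrite -defY dimv_disjoint_sum// dim_vline v0.
have [|e eb eo] := IH Y' dY'.
  by move=> a b /memv_capP[aY _] /memv_capP[bY _]; exact: Bs.
exists (v :: e).
  rewrite -defY -cat1s; apply: cat_basis => //; first exact/directv_addP.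
  exact: seq1_basis.
have ve i : B v e`_i = 0.
  have [lt|ge] := ltnP i (size e); last by rewrite nth_default ?bil0r.
  have /memv_capP[_] := basis_mem eb (mem_nth 0 lt).
  by rewrite memv_ker gE => /eqP.
have eY i : e`_i \in Y.
  have [lt|ge] := ltnP i (size e); last by rewrite nth_default ?mem0v.
  by have /memv_capP[] := basis_mem eb (mem_nth 0 lt).
move=> [|i] [|j] //= ij; first by rewrite Bs.
exact: eo.
Qed.

End Bilinear.

(** * Sylvester's law of inertia *)

Section Inertia.
Context {R : realType}.

(* Sylvester's law without a basis: [N] is a maximal negative definite subspace. *)
Definition inertia (U : vectType R) (q : U -> R) (m : nat) : Prop :=
  exists N P : {vspace U}, [/\ \dim N = m, (\dim P + m)%N = \dim {:U},
    forall u, u \in N -> u != 0 -> q u < 0 & forall u, u \in P -> 0 <= q u].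

(** A subspace where one decomposition is negative definite meets trivially a subspace where the
    other is nonnegative, so its dimension is at most the codimension of the latter. *)
Lemma inertia_uniq (U : vectType R) (q : U -> R) (m m' : nat) :
  inertia q m -> inertia q m' -> m = m'.
Proof.
suff le a b : inertia q a -> inertia q b -> (a <= b)%N.
  by move=> qm qm'; apply/eqP; rewrite eqn_leq !le.
move=> [N [_ [<- _ Nneg _]]] [_ [P [_ dP _ Ppos]]].
have NP : (N :&: P = 0)%VS.
  apply/eqP; rewrite -subv0; apply/subvP => u /memv_capP[uN uP].
  rewrite memv0; apply/negPn/negP => u0.
  by have := Nneg _ uN u0; rewrite ltNge Ppos.
have := dimvS (subvf (N + P)%VS).
by rewrite dimv_disjoint_sum// -dP addnC leq_add2l.
Qed.

Lemma inertia_transport (U U' : vectType R) (f : U -> U') q q' m :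
  linear f -> injective f -> \dim {:U} = \dim {:U'} ->
  (forall u, q' (f u) = q u) -> inertia q m -> inertia q' m.
Proof.
move=> fl finj dU qf [N [P [dN dP Nneg Ppos]]].
pose fL : {linear U -> U'} := HB.pack f (GRing.isLinear.Build _ _ _ _ _ fl).
pose g := linfun fL; have gE u : g u = f u by rewrite lfunE.
have g0 : lker g == 0%VS by apply/lker0P => u v; rewrite !gE; exact: finj.
have dimg (W : {vspace U}) : \dim (g @: W) = \dim W.
  by apply: limg_dim_eq; rewrite (eqP g0) capv0.
exists (g @: N)%VS, (g @: P)%VS; split; rewrite ?dimg -?dU//.
  move=> _ /memv_imgP[u uN ->] gu0; rewrite gE qf Nneg//.
  by apply: contraNneq gu0 => ->; rewrite linear0.
by move=> _ /memv_imgP[u uP ->]; rewrite gE qf Ppos.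
Qed.

(** Negative and nonnegative subspaces add up along the two injections. As [q1] and [q2] are
    arbitrary functions, their values at 0 are prescribed; these enter for pairs with one zero
    component. *)
Lemma inertia_sum (U1 U2 : vectType R) q1 q2 m1 m2 :
  q1 0 = 0 -> q2 0 = 0 -> inertia q1 m1 -> inertia q2 m2 ->
  inertia (fun u : (U1 * U2)%type => q1 u.1 + q2 u.2) (m1 + m2).
Proof.
move=> q10 q20.
have in1l : linear (fun u : U1 => (u, 0 : U2)).
  by move=> a u v; congr pair => /=; rewrite scaler0 addr0.
have in2l : linear (fun u : U2 => (0 : U1, u)).
  by move=> a u v; congr pair => /=; rewrite scaler0 addr0.
pose h1 : {linear U1 -> (U1 * U2)%type} :=
  HB.pack (fun u : U1 => (u, 0 : U2)) (GRing.isLinear.Build _ _ _ _ _ in1l).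
pose h2 : {linear U2 -> (U1 * U2)%type} :=
  HB.pack (fun u : U2 => (0 : U1, u)) (GRing.isLinear.Build _ _ _ _ _ in2l).
pose f1 := linfun h1; pose f2 := linfun h2.
have f1E u : f1 u = (u, 0) by rewrite lfunE.
have f2E u : f2 u = (0, u) by rewrite lfunE.
have f10 : lker f1 == 0%VS by apply/lker0P => u v; rewrite !f1E => -[].
have f20 : lker f2 == 0%VS by apply/lker0P => u v; rewrite !f2E => -[].
have dimD W1 W2 : \dim (f1 @: W1 + f2 @: W2) = (\dim W1 + \dim W2)%N.
  rewrite dimv_disjoint_sum.
    by rewrite !limg_dim_eq// ?(eqP f10) ?(eqP f20) capv0.
  apply/eqP; rewrite -subv0; apply/subvP => u /memv_capP[].
  move=> /memv_imgP[a _ ->] /memv_imgP[b _]; rewrite f1E f2E => -[-> _].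
  by rewrite memv0.
have memD W1 W2 (u : (U1 * U2)%type) : u \in (f1 @: W1 + f2 @: W2)%VS ->
    u.1 \in W1 /\ u.2 \in W2.
  case/memv_addP => _ /memv_imgP[a aW ->] [_ /memv_imgP[b bW ->] ->].
  by rewrite f1E f2E /= addr0 add0r.
move=> [N1 [P1 [dN1 dP1 N1n P1p]]] [N2 [P2 [dN2 dP2 N2n P2p]]].
exists (f1 @: N1 + f2 @: N2)%VS, (f1 @: P1 + f2 @: P2)%VS; split.
- by rewrite dimD dN1 dN2.
- have -> : (fullv : {vspace (U1 * U2)%type}) = (f1 @: fullv + f2 @: fullv)%VS.
    apply/eqP; rewrite eqEsubv subvf andbT; apply/subvP => -[a b] _.
    apply/memv_addP; exists (f1 a); first by rewrite memv_img ?memvf.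
    exists (f2 b); first by rewrite memv_img ?memvf.
    by rewrite f1E f2E; congr pair => /=; rewrite ?addr0 ?add0r.
  by rewrite !dimD -dP1 -dP2 addnACA.
- move=> [a b] /memD[/= aN bN]; rewrite -pair_eqE /pair_eq /= negb_and.
  have [->|a0] := eqVneq a 0; first by rewrite q10 add0r; exact: N2n.
  move=> _; have [->|b0] := eqVneq b 0; first by rewrite q20 addr0 N1n.
  by rewrite addrC ltr_wnDr ?N2n// ltW ?N1n.
- by move=> [a b] /memD[/= aP bP]; rewrite addr_ge0 ?P1p ?P2p.
Qed.
End Inertia.

(** * From diagonal bases to negative subspaces *)

Section Index.
Context {R : realType} {U V : vectType R}.

Lemma dim_sub_free (r : nat) (e : r.-tuple V) (A : pred 'I_r) : free e ->
  \dim (\sum_(i | A i) <[e`_i]>)%VS = #|A|.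
Proof.
move=> fe.
have e0 i : e`_i != 0 :> V -> \dim <[e`_i]> = 1%N by rewrite dim_vline => ->.
have dir : directv (\sum_(i | A i) <[e`_i]>)%VS.
  apply/directv_sum_independent => us usE sum0 i Ai.
  pose k i := xget 0 [set k | us i = k *: e`_i].
  have kE j : A j -> us j = k j *: e`_j.
    move=> /usE /vlineP ex.
    exact: (@xgetPex _ _ [set k | us j = k *: e`_j] ex).
  have /freeP/(_ (fun j => if A j then k j else 0)) := fe.
  have -> : \sum_(j < r) (if A j then k j else 0) *: e`_j = 0.
    rewrite -[RHS]sum0 [RHS]big_mkcond; apply: eq_bigr => j _.
    by case: ifPn => [/kE|_]; rewrite ?scale0r.
  by move/(_ erefl i); rewrite Ai kE// => ->; rewrite scale0r.
rewrite (directvP dir) /= -sum1_card; apply: eq_bigr => i _.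
rewrite e0//; apply: (free_not0 fe); apply: mem_nth; by rewrite size_tuple.
Qed.

Lemma mem_sum_line (r : nat) (e : r.-tuple V) (A : pred 'I_r) v :
  v \in (\sum_(i | A i) <[e`_i]>)%VS ->
  exists2 t : 'I_r -> R, v = \sum_i t i *: e`_i & forall i, ~~ A i -> t i = 0.
Proof.
case/memv_sumP => us usE ->.
pose k i := xget 0 [set k | us i = k *: e`_i].
have kE j : A j -> us j = k j *: e`_j.
  move=> /usE /vlineP ex.
  exact: (@xgetPex _ _ [set k | us j = k *: e`_j] ex).
exists (fun i => if A i then k i else 0); last by move=> i /negPf ->.
rewrite big_mkcond; apply: eq_bigr => j _.
by case: ifPn => [/kE|_]; rewrite ?scale0r.
Qed.

(** The map [f] parametrizes [Y]. The basis vectors with negative coefficient span the negative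
    subspace; the remaining ones, together with the radical directions [K], span the nonnegative
    one. Both are pulled back along [f]. *)
Lemma diagonal_basis_inertia (Q : V -> R) (Y K : {vspace V}) (f : 'Hom(U, V))
    r (e : r.-tuple V) (c : 'I_r -> R) :
  lker f == 0%VS -> limg f = Y -> diagonal_basis Q Y K e c ->
  inertia (fun u => Q (f u)) #|[pred i | c i < 0]|.
Proof.
move=> f0 fY [fe dK YE QE].
pose N := (\sum_(i | (c i < 0)%R) <[e`_i]>)%VS.
pose P := (\sum_(i | ~~ (c i < 0)%R) <[e`_i]>)%VS.
have sub (A : pred 'I_r) : (\sum_(i | A i) <[e`_i]> <= <<e>>)%VS.
  apply/subv_sumP => i _; rewrite -memvE memv_span// mem_nth//.
  by rewrite size_tuple.
have dimpre (W : {vspace V}) : (W <= Y)%VS -> \dim (f @^-1: W) = \dim W.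
  move=> WY; rewrite -[in RHS](@lpreimK _ _ _ f W) ?fY// limg_dim_eq//.
  by rewrite (eqP f0) capv0.
have KY : (K <= Y)%VS by rewrite -YE addvSl.
have eY : (<<e>> <= Y)%VS by rewrite -YE addvSr.
have dUY : \dim {:U} = \dim Y.
  by rewrite -fY limg_dim_eq// (eqP f0) capv0.
have KP : (K :&: P = 0)%VS.
  by apply/eqP; rewrite -subv0 -dK capvS ?subvv ?sub.
exists (f @^-1: N)%VS, (f @^-1: (K + P))%VS; split.
- by rewrite dimpre ?(subv_trans (sub _))// dim_sub_free.
- rewrite dimpre; last by rewrite subv_add KY (subv_trans (sub _)).
  rewrite dimv_disjoint_sum// dim_sub_free// dUY -YE dimv_disjoint_sum//.
  rewrite -addnA; congr addn.
  move: fe; rewrite /free => /eqP ->; rewrite size_tuple -[RHS]card_ord.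
  by rewrite addnC -[RHS](cardC [pred i | c i < 0]).
- move=> u; rewrite -memv_preim => /mem_sum_line[t tE t0] u0.
  have := QE t 0 (mem0v _); rewrite addr0 -tE => ->.
  have le i : c i * t i ^+ 2 <= 0.
    have [ci|ci] := boolP (c i < 0).
      by rewrite mulr_le0_ge0 ?sqr_ge0 ?ltW.
    by rewrite t0// expr0n mulr0.
  rewrite lt_neqAle; apply/andP; split; last first.
    by rewrite -oppr_ge0 -sumrN sumr_ge0// => i _; rewrite oppr_ge0.
  apply: contraNneq u0 => sum0.
  suff t00 i : t i = 0.
    move/lker0P: f0 => finj; apply/eqP/finj; rewrite tE linear0.
    by apply: big1 => i _; rewrite t00 scale0r.
  have [ci|ci] := boolP (c i < 0); last exact: t0.
  have : \sum_i - (c i * t i ^+ 2) == 0 by rewrite sumrN sum0 oppr0.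
  rewrite psumr_eq0; last by move=> j _; rewrite oppr_ge0.
  move=> /allP/(_ i (mem_index_enum _)); rewrite implyTb oppr_eq0 mulf_eq0.
  by rewrite lt_eqF//= sqrf_eq0 => /eqP.
- move=> u; rewrite -memv_preim => /memv_addP[k kK [v /mem_sum_line[t tE t0] ->]].
  rewrite addrC tE QE//; apply: sumr_ge0 => i _.
  have [ci|ci] := boolP (c i < 0); first by rewrite t0 ?ci// expr0n mulr0.
  by rewrite mulr_ge0 ?sqr_ge0// leNgt.
Qed.

(** An orthogonal basis of a complement of [K] in [Y] is a diagonal basis, because [K] is orthogonal
    to [Y]. This ties [ind], defined by a choice, to [inertia]. *)
Lemma ind_inertia (B : V -> V -> R) (Q : V -> R) (Y K : {vspace V})
    (f : 'Hom(U, V)) :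
  bilin B -> {in Y &, forall u v, B u v = B v u} ->
  (forall v, v \in Y -> Q v = B v v) ->
  (K <= Y)%VS -> {in K & Y, forall u v, B u v = 0} ->
  lker f == 0%VS -> limg f = Y ->
  inertia (fun u => Q (f u)) (ind Q Y K).
Proof.
move=> Bb Bs QB KY K0 f0 fY.
have [e eb eo] : exists2 e : seq V, basis_of (Y :\: K)%VS e &
    forall i j, i != j -> B e`_i e`_j = 0.
  apply: orthogonal_basis => // u v uY vY.
  by apply: Bs; [move: uY|move: vY]; exact/subvP/diffvSl.
have eD i : e`_i \in (Y :\: K)%VS.
  have [lt|ge] := ltnP i (size e); last by rewrite nth_default ?mem0v.
  exact: basis_mem eb (mem_nth 0 lt).
have eY i : e`_i \in Y by exact: (subvP (diffvSl Y K)).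
suff [r [e' [c [dia ->]]]] : [set m | exists (r : nat) (e : r.-tuple V)
    (c : 'I_r -> R), diagonal_basis Q Y K e c /\ m = #|[pred i | c i < 0]|]
    (ind Q Y K).
  exact: diagonal_basis_inertia dia.
(* Exhibiting one diagonal basis shows that [xget] returns a member of the set and not its default
   0. *)
apply: xgetPex; exists #|[pred i : 'I_(size e) | B e`_i e`_i < 0]|.
exists (size e), (in_tuple e), (fun i => B e`_i e`_i); split=> //.
split; first exact: basis_free eb.
- by rewrite /= (span_basis eb) capvC capv_diff.
- rewrite /= (span_basis eb) addvC.
  by have := addv_diff_cap Y K; rewrite (capv_idPr KY).
move=> t k kK /=; set s := \sum_i _.
have sY : s \in Y by apply: memv_suml => i _; rewrite memvZ.
have kY : k \in Y by exact: (subvP KY).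
rewrite QB ?memvD// (bilDl Bb) !(bilDr Bb).
rewrite (K0 k)// (K0 k)// (Bs s k)// (K0 k)// !addr0.
rewrite /s (bil_suml Bb); apply: eq_bigr => i _; rewrite (bil_sumr Bb).
rewrite (bigD1 i)//= big1 ?addr0 => [|j ji].
  by rewrite (bilZl Bb) (bilZr Bb); ring.
by rewrite (bilZl Bb) (bilZr Bb) eo ?mulr0// eq_sym.
Qed.

End Index.

(** * Index of a continuous family of nondegenerate forms *)

Section InertiaNear.
Context {R : realType} {T : topologicalType} {U : vectType R}.

(** Diagonalize the form at [x0], with coefficients [c i], and set [S t = \sum_i |c i| * t i ^+ 2].
    The form at [x0] is [- S] on the span of the negative basis vectors and [S] on that of the
    others. A form with nearby entries differs from it by at most a fixed fraction of [S], so the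
    same two subspaces serve for all nearby [x]. *)
Lemma inertia_near (x0 : T) (B : T -> U -> U -> R) :
  (forall x, bilin (B x)) -> (forall x u v, B x u v = B x v u) ->
  (forall u v, (fun x => B x u v) @ x0 --> B x0 u v) ->
  (forall u, (forall v, B x0 u v = 0) -> u = 0) ->
  exists m, \forall x \near x0, inertia (fun u => B x u u) m.
Proof.
move=> Bb Bs Bc Bn.
have [e eb eo] : exists2 e : seq U, basis_of fullv e &
    forall i j, i != j -> B x0 e`_i e`_j = 0.
  by apply: orthogonal_basis => // u v _ _; exact: Bs.
pose d := size e; pose c (i : 'I_d) := B x0 e`_i e`_i.
have fe : free (in_tuple e) by exact: basis_free eb.
have expand u : exists t : 'I_d -> R, u = \sum_i t i *: e`_i.
  exists (fun i => coord (in_tuple e) i u).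
  exact: (coord_basis (X := in_tuple e) eb (memvf u)).
(* A basis vector with [c i = 0] would be orthogonal to the whole basis, against nondegeneracy at
   [x0]. *)
have c0 i : c i != 0.
  apply/eqP => ci; have /eqP := free_not0 fe (mem_nth 0 (ltn_ord i)).
  apply; apply: Bn => v; have [t ->] := expand v.
  rewrite (bil_sumr (Bb x0)) big1 // => j _; rewrite (bilZr (Bb x0)).
  have [->|ij] := eqVneq j i; first by rewrite -/(c i) ci mulr0.
  by rewrite eo ?mulr0// eq_sym.
pose D x (i j : 'I_d) := B x e`_i e`_j - B x0 e`_i e`_j.
(* The divisor [d.+1] makes the total error at most [d / d.+1] times [S t], hence smaller than [S t]
   when [S t] is positive; it is nonzero also for [d = 0]. *)
have near_small : \forall x \near x0, forall i j, `|D x i j| <= `|c i| / d.+1%:R.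
  apply: filter_forall => i; apply: filter_forall => j.
  have e0 : 0 < `|c i| / d.+1%:R by rewrite divr_gt0 ?normr_gt0.
  have /cvgrPdist_le/(_ _ e0) := Bc e`_i e`_j.
  by apply: filterS => x; rewrite distrC.
pose S (t : 'I_d -> R) : R := \sum_i `|c i| * t i ^+ 2.
have S0 t : 0 <= S t by apply: sumr_ge0 => i _; rewrite mulr_ge0 ?sqr_ge0.
have est x (t : 'I_d -> R) : (forall i j, `|D x i j| <= `|c i| / d.+1%:R) ->
    `|B x (\sum_i t i *: e`_i) (\sum_i t i *: e`_i) - \sum_i c i * t i ^+ 2|
    <= d%:R / d.+1%:R * S t.
  move=> Dx; have m0 : d.+1%:R != 0 :> R by rewrite pnatr_eq0.
  have -> : B x (\sum_i t i *: e`_i) (\sum_i t i *: e`_i) - \sum_i c i * t i ^+ 2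
      = \sum_i \sum_j t i * t j * D x i j.
    rewrite (bil_suml (Bb x)) -sumrB; apply: eq_bigr => i _.
    rewrite (bil_sumr (Bb x)).
    have -> : c i * t i ^+ 2 = \sum_j t i * t j * B x0 e`_i e`_j.
      rewrite (bigD1 i)//= big1 ?addr0 => [|j ji]; first by rewrite /c; ring.
      by rewrite eo ?mulr0// eq_sym.
    rewrite -sumrB; apply: eq_bigr => j _.
    by rewrite (bilZl (Bb x)) (bilZr (Bb x)) /D; ring.
  (* By symmetry [D x i j] obeys the bound attached to [i] and the one attached to [j]. Together
     with [2 |t i t j| <= t i ^+ 2 + t j ^+ 2] this turns the double sum into a multiple of
     [S t]. *)
  apply: (@le_trans _ _ (\sum_i \sum_j
      (`|c i| * t i ^+ 2 + `|c j| * t j ^+ 2) / (2 * d.+1%:R))).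
    apply: le_trans (ler_norm_sum _ _ _) _; apply: ler_sum => i _.
    apply: le_trans (ler_norm_sum _ _ _) _; apply: ler_sum => j _.
    have Dij : `|D x i j| <= `|c i| / d.+1%:R by [].
    have Dji : `|D x i j| <= `|c j| / d.+1%:R by rewrite /D !(Bs _ e`_i) Dx.
    rewrite !normrM -[t i ^+ 2]real_normK ?num_real//.
    rewrite -[t j ^+ 2]real_normK ?num_real//.
    rewrite invfM mulrA.
    set a := `|t i|; set b := `|t j|; set r := `|D x i j|.
    have r0 : 0 <= r by exact: normr_ge0.
    rewrite -/r in Dij Dji.
    have ha := ler_wpM2r (sqr_ge0 a) Dij.
    have hb := ler_wpM2r (sqr_ge0 b) Dji.
    have hr : 0 <= r * (a - b) ^+ 2 by rewrite mulr_ge0 ?sqr_ge0.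
    rewrite !expr2 in ha hb hr *.
    set k := (_ / _) in ha; set k' := (_ / _) in hb.
    have -> : (`|c i| * (a * a) + `|c j| * (b * b)) / 2 / d.+1%:R =
      (k * (a * a) + k' * (b * b)) / 2.
      by rewrite /k /k'; move: (d.+1%:R) m0 => m m0; field.
    have e2 : r * ((a - b) * (a - b)) = r * (a * a) + r * (b * b) - 2 * (a * b * r).
      by ring.
    rewrite e2 in hr.
    by lra.
  rewrite le_eqVlt; apply/orP; left; apply/eqP.
  under eq_bigr => i _ do rewrite -mulr_suml big_split /= sumr_const card_ord -/(S t).
  rewrite -mulr_suml big_split /= sumr_const card_ord sumrMnl -/(S t).
  rewrite -mulr_natr.
  by move: (d.+1%:R) m0 => m m0; field.
have Spos (t : 'I_d -> R) : \sum_i t i *: e`_i != 0 -> 0 < S t.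
  move=> u0; rewrite lt_neqAle S0 andbT eq_sym; apply: contraNneq u0.
  move/eqP; rewrite psumr_eq0 => [/allP St|i _]; last by rewrite mulr_ge0 ?sqr_ge0.
  apply/eqP/big1 => i _; have := St i (mem_index_enum _).
  rewrite implyTb mulf_eq0 normr_eq0 (negPf (c0 i)) sqrf_eq0 => /eqP ->.
  exact: scale0r.
have dd : d%:R / d.+1%:R < 1 :> R by rewrite ltr_pdivrMr// mul1r ltr_nat.
exists #|[pred i | c i < 0]|; near=> x.
have Dx : forall i j, `|D x i j| <= `|c i| / d.+1%:R by near: x.
pose N := (\sum_(i | (c i < 0)%R) <[(in_tuple e)`_i]>)%VS.
pose P := (\sum_(i | ~~ (c i < 0)%R) <[(in_tuple e)`_i]>)%VS.
exists N, P; split.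
- by rewrite dim_sub_free.
- rewrite dim_sub_free// -(span_basis eb).
  move: fe; rewrite /free => /eqP ->; rewrite -[RHS]card_ord.
  by rewrite addnC -[RHS](cardC [pred i | c i < 0]).
- move=> u /mem_sum_line[t -> t0] u0.
  have := est x t Dx; rewrite ler_norml => /andP[_].
  have -> : \sum_i c i * t i ^+ 2 = - S t.
    rewrite /S -sumrN; apply: eq_bigr => i _.
    have [ci|ci] := boolP (c i < 0); first by rewrite ltr0_norm// mulNr opprK.
    by rewrite t0// expr0n !mulr0 oppr0.
  have := Spos t u0; move: (S t) => s s0.
  have : d%:R / d.+1%:R * s < 1 * s by rewrite ltr_pM2r.
  rewrite mul1r; move: (_ / _ * s) => r; move: (B x _ _) => b h1 h2; lra.
- move=> u /mem_sum_line[t -> t0].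
  have := est x t Dx; rewrite ler_norml => /andP[+ _].
  have -> : \sum_i c i * t i ^+ 2 = S t.
    apply: eq_bigr => i _.
    have [ci|ci] := boolP (c i < 0); first by rewrite t0 ?ci// expr0n !mulr0.
    by rewrite ger0_norm// leNgt.
  move: (S t) (S0 t) => s s0.
  have : d%:R / d.+1%:R * s <= 1 * s by rewrite ler_wpM2r// ltW.
  rewrite mul1r; move: (_ / _ * s) => r; move: (B x _ _) => b h1 h2; lra.
Unshelve. all: by end_near. Qed.

End InertiaNear.

(** * Lagrangian planes and the Hormander index *)

Lemma linform_ext (R : realType) (V : vectType R) (u v : V) :
  (forall f : V -> R, scalar f -> f u = f v) -> u = v.
Proof.
move=> uv; rewrite (coord_vbasis (memvf u)) (coord_vbasis (memvf v)).
by apply: eq_bigr => i _; rewrite (uv (coord (vbasis fullv) i))// => a x y;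
  rewrite linearP.
Qed.

(* Decides linear identities in a [vectType] by testing them on functionals. *)
Ltac vec := let f := fresh in let fl := fresh in
  apply: linform_ext; intros f fl;
  rewrite ?(linformD fl, linformN fl, linformZ fl, linform0 fl);
  by field.

(** * Quadratic forms attached to four Lagrangian planes *)

Section HormanderIdentity.
Context {R : realType} {K V : vectType R}.
Variables (w : V -> V -> R) (ws : symplectic_form w).

Lemma symplectic_bilin : bilin w.
Proof. by split; [exact: form_linear_r|exact: form_linear_l]. Qed.
Let wb := symplectic_bilin.

Lemma symplectic_anti u v : w u v = - w v u.
Proof.
have := form_alternating ws (u + v).
rewrite (bilDl wb) !(bilDr wb) !(form_alternating ws) add0r addr0.
by move/eqP; rewrite addr_eq0 => /eqP.
Qed.

Definition isotropic (X : {vspace V}) := {in X &, forall u v, w u v = 0}.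

(* With x, y, z, t in X, Y, Z, W, the quadratic form of [four_plane_form] is
     - (w x y + w x t - w x z + w y t + w y z + w t z).
   For Z and W transversal to X and Y it is nondegenerate whatever the dimension
   of the intersection of X and Y, and by [inertia_identity] its index is, up to
   that of the nondegenerate [pairing_form], the index of Q_Z minus that of Q_W.
   Arguments are grouped as ((x, y), (z, t)). *)
Definition four_plane_bilin (fX fY fZ fW : K -> V)
    (u v : ((K * K) * (K * K))%type) : R :=
  w (fX u.1.1) (fY v.1.2) + w (fX u.1.1) (fW v.2.2) - w (fX u.1.1) (fZ v.2.1)
  + w (fY u.1.2) (fW v.2.2) + w (fY u.1.2) (fZ v.2.1) + w (fW u.2.2) (fZ v.2.1).

Definition four_plane_form (fX fY fZ fW : K -> V)
    (u v : ((K * K) * (K * K))%type) : R :=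
  - (four_plane_bilin fX fY fZ fW u v + four_plane_bilin fX fY fZ fW v u) / 2.

(** On arguments ((p, q), (x, z)) the quadratic form of [pairing_form] is [- 2 w p q + w x z]: the
    two hyperbolic terms left over by the change of variables in [inertia_identity]. *)
Definition pairing_bilin (fX fZ : K -> V) (u v : ((K * K) * (K * K))%type) : R :=
  w (fX u.1.1) (fZ v.1.2) *+ 2 - w (fX u.2.1) (fZ v.2.2).

Definition pairing_form (fX fZ : K -> V) (u v : ((K * K) * (K * K))%type) : R :=
  - (pairing_bilin fX fZ u v + pairing_bilin fX fZ v u) / 2.

Lemma mem_limg (f : 'Hom(K, V)) (A : {vspace V}) :
  limg f = A -> forall x, f x \in A.
Proof. by move=> <- x; rewrite memv_img ?memvf. Qed.

Section Forms.
Variables (X Y Z W : {vspace V}).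
Variables (fX fY fZ fW : 'Hom(K, V)).
Hypotheses (X0 : isotropic X) (Y0 : isotropic Y) (Z0 : isotropic Z)
  (W0 : isotropic W).
Hypotheses (XZ : (X :&: Z = 0)%VS) (XZV : (X + Z = fullv)%VS).
Hypotheses (YZ : (Y :&: Z = 0)%VS) (YZV : (Y + Z = fullv)%VS).
Hypotheses (XW : (X :&: W = 0)%VS) (XWV : (X + W = fullv)%VS).
Hypotheses (YW : (Y :&: W = 0)%VS).
Hypotheses (kX : lker fX == 0%VS) (iX : limg fX = X).
Hypotheses (kY : lker fY == 0%VS) (iY : limg fY = Y).
Hypotheses (kZ : lker fZ == 0%VS) (iZ : limg fZ = Z).
Hypotheses (kW : lker fW == 0%VS) (iW : limg fW = W).

(** The component of [v] in [B] is orthogonal to [A], by assumption and isotropy of [A], and to [B],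
    hence to everything; so it is 0. *)
Lemma lagrangian_perp (A B : {vspace V}) v : isotropic A -> isotropic B ->
  (A + B = fullv)%VS -> (forall u, u \in A -> w u v = 0) -> v \in A.
Proof.
move=> A0 B0 AB vA.
have /memv_addP[a aA [b bB vE]] : v \in (A + B)%VS by rewrite AB memvf.
suff b0 : b = 0 by rewrite vE b0 addr0.
apply: (form_nondegenerate ws) => u.
have /memv_addP[a' a'A [b' b'B ->]] : u \in (A + B)%VS by rewrite AB memvf.
rewrite (bilDr wb) (B0 b b')// addr0 symplectic_anti.
have := vA _ a'A; rewrite vE (bilDr wb) A0// add0r => ->; exact: oppr0.
Qed.

Lemma four_plane_bilin_linear : bilin (four_plane_bilin fX fY fZ fW).
Proof.
by split=> u a v v'; rewrite /four_plane_bilin /= !linearP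
  ?(bilDr wb, bilZr wb, bilDl wb, bilZl wb); ring.
Qed.

Lemma four_plane_form_linear : bilin (four_plane_form fX fY fZ fW).
Proof.
have [br bl] := four_plane_bilin_linear.
by split=> u a v v'; rewrite /four_plane_form (br u a v v') (bl u a v v'); field.
Qed.

Lemma pairing_bilin_linear : bilin (pairing_bilin fX fZ).
Proof.
by split=> u a v v'; rewrite /pairing_bilin /= !linearP
  ?(bilDr wb, bilZr wb, bilDl wb, bilZl wb); ring.
Qed.

Lemma pairing_form_linear : bilin (pairing_form fX fZ).
Proof.
have [br bl] := pairing_bilin_linear.
by split=> u a v v'; rewrite /pairing_form (br u a v v') (bl u a v v'); field.
Qed.

Lemma pairing_form_nondegenerate u :
  (forall v, pairing_form fX fZ u v = 0) -> u = 0.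
Proof.
have f0 (f : 'Hom(K, V)) x : lker f == 0%VS -> f x = 0 -> x = 0.
  by move=> /lker0P fi fx; apply: fi; rewrite fx linear0.
have ZXV : (Z + X = fullv)%VS by rewrite addvC.
have inZ a : (forall x, w (fX x) a = 0) -> a \in X.
  move=> xa; apply: (lagrangian_perp X0 Z0 XZV) => b.
  by rewrite -iX => /memv_imgP[c _ ->]; exact: xa.
have inX a : (forall z, w a (fZ z) = 0) -> a \in Z.
  move=> za; apply: (lagrangian_perp Z0 X0 ZXV) => b.
  by rewrite -iZ symplectic_anti => /memv_imgP[c _ ->]; rewrite za oppr0.
have XZ0 a : a \in X -> a \in Z -> a = 0.
  by move=> aX aZ; apply/eqP; rewrite -memv0 -XZ memv_cap aX.
case: u => -[p q] [x z] H.
(* Each of the four test vectors has a single nonzero entry, which isolates one component. That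
   component then lies in both [X] and [Z]. *)
have Hp : p = 0.
  apply: (f0 fX) => //; apply: XZ0; rewrite ?(mem_limg iX)//; apply: inX => a.
  have := H ((0, a), (0, 0)); rewrite /pairing_form /pairing_bilin /= !linear0.
  rewrite !(bil0l wb) !(bil0r wb); by lra.
have Hq : q = 0.
  apply: (f0 fZ) => //; apply: XZ0; rewrite ?(mem_limg iZ)//; apply: inZ => a.
  have := H ((a, 0), (0, 0)); rewrite /pairing_form /pairing_bilin /= !linear0.
  rewrite !(bil0l wb) !(bil0r wb); by lra.
have Hx : x = 0.
  apply: (f0 fX) => //; apply: XZ0; rewrite ?(mem_limg iX)//; apply: inX => a.
  have := H ((0, 0), (0, a)); rewrite /pairing_form /pairing_bilin /= !linear0.
  rewrite !(bil0l wb) !(bil0r wb); by lra.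
have Hz : z = 0.
  apply: (f0 fZ) => //; apply: XZ0; rewrite ?(mem_limg iZ)//; apply: inZ => a.
  have := H ((0, 0), (a, 0)); rewrite /pairing_form /pairing_bilin /= !linear0.
  rewrite !(bil0l wb) !(bil0r wb); by lra.
by rewrite Hp Hq Hx Hz.
Qed.

(** Testing on each of the four factors gives a vector orthogonal to one plane, hence lying in that
    plane. These memberships force [x + z = y + t], and eliminating [z] then puts [x] in [W], [t] in
    [Y] and [z] in [Y]; transversality kills them one after the other. *)
Lemma four_plane_form_nondegenerate u :
  (forall v, four_plane_form fX fY fZ fW u v = 0) -> u = 0.
Proof.
have f0 (f : 'Hom(K, V)) x : lker f == 0%VS -> f x = 0 -> x = 0.
  by move=> /lker0P fi fx; apply: fi; rewrite fx linear0.
have dis (A B : {vspace V}) a : (A :&: B = 0)%VS -> a \in A -> a \in B -> a = 0.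
  by move=> AB aA aB; apply/eqP; rewrite -memv0 -AB memv_cap aA.
case: u => -[x y] [z t] H.
have HX : fY y + fW t - fZ z \in X.
  apply: (lagrangian_perp X0 Z0 XZV) => b; rewrite -iX => /memv_imgP[a _ ->].
  have := H ((a, 0), (0, 0)); rewrite /four_plane_form /four_plane_bilin /= !linear0.
  rewrite !(bil0l wb) !(bil0r wb) !(bilDr wb) (bilNr wb); by lra.
have HY : fW t + fZ z - fX x \in Y.
  apply: (lagrangian_perp Y0 Z0 YZV) => b; rewrite -iY => /memv_imgP[a _ ->].
  have := H ((0, a), (0, 0)); rewrite /four_plane_form /four_plane_bilin /= !linear0.
  rewrite !(bil0l wb) !(bil0r wb) !(bilDr wb) (bilNr wb).
  by rewrite (symplectic_anti (fX x)); lra.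
have HZ : fX x - fY y - fW t \in Z.
  apply: (lagrangian_perp Z0 X0); first by rewrite addvC.
  move=> b; rewrite -iZ => /memv_imgP[a _ ->].
  have := H ((0, 0), (a, 0)); rewrite /four_plane_form /four_plane_bilin /= !linear0.
  rewrite !(bil0l wb) !(bil0r wb) !(bilDr wb) !(bilNr wb).
  by rewrite !(symplectic_anti (fZ a)); lra.
have HW : fZ z - fX x - fY y \in W.
  apply: (lagrangian_perp W0 X0); first by rewrite addvC.
  move=> b; rewrite -iW => /memv_imgP[a _ ->].
  have := H ((0, 0), (0, a)); rewrite /four_plane_form /four_plane_bilin /= !linear0.
  rewrite !(bil0l wb) !(bil0r wb) !(bilDr wb) !(bilNr wb).
  by rewrite (symplectic_anti (fX x)) (symplectic_anti (fY y)); lra.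
have xX := mem_limg iX x; have yY := mem_limg iY y.
have zZ := mem_limg iZ z; have tW := mem_limg iW t.
have e1 : fX x + fZ z = fY y + fW t.
  apply: subr0_eq; apply: (dis _ _ _ XZ).
    have -> : fX x + fZ z - (fY y + fW t) = fX x - (fY y + fW t - fZ z) by vec.
    by rewrite memvB.
  have -> : fX x + fZ z - (fY y + fW t) = fZ z + (fX x - fY y - fW t) by vec.
  by rewrite memvD.
have ez : fZ z = fY y + fW t - fX x by rewrite -e1; vec.
have x0 : fX x = 0.
  apply: (dis _ _ _ XW) => //.
  rewrite (_ : fX x = 2^-1 *: (fW t - (fZ z - fX x - fY y))).
    by rewrite memvZ// memvB.
  by rewrite ez; vec.
have t0 : fW t = 0.
  apply: (dis _ _ _ YW) => //.
  rewrite (_ : fW t = 2^-1 *: ((fW t + fZ z - fX x) - fY y)).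
    by rewrite memvZ// memvB.
  by rewrite ez x0; vec.
have z0 : fZ z = 0.
  apply: (dis _ _ _ YZ) => //.
  by rewrite ez x0 t0 subr0 addr0.
have y0 : fY y = 0.
  by have := e1; rewrite x0 t0 z0 !addr0 => <-.
by rewrite (f0 _ _ kX x0) (f0 _ _ kY y0) (f0 _ _ kZ z0) (f0 _ _ kW t0).
Qed.

Lemma inertia_identity r h mZ mW :
  inertia (fun u => four_plane_form fX fY fZ fW u u) r ->
  inertia (fun u => pairing_form fX fZ u u) h ->
  inertia (fun y => hform w X Z (fY y)) mZ ->
  inertia (fun y => hform w X W (fY y)) mW ->
  (r + mW = mZ + h)%N.
Proof.
move=> ir ih iZm iWm.
(* Write a_X and a_Z for the components of a in V = X + Z, and v for the
   projection of y' onto W along X, so that v_Z = y'_Z.  Then, with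
     p = (y + t / 2 + v / 2)_X  and  q = (t - v)_Z,
   isotropy of Y and of W gives
     four_plane_form (x, y, z, t) + Q_W y' =
       Q_Z (y + y') - 2 w p q + w (x - (y + t)_X) (z - (y + t)_Z). *)
pose pX := daddv_pi X Z; pose pZ := daddv_pi Z X; pose pW := daddv_pi W X.
have dis (A B : {vspace V}) a : (A :&: B = 0)%VS -> a \in A -> a \in B -> a = 0.
  by move=> AB aA aB; apply/eqP; rewrite -memv0 -AB memv_cap aA.
have ZX : (Z :&: X = 0)%VS by rewrite capvC.
have WX : (W :&: X = 0)%VS by rewrite capvC.
have dec u : u = pX u + pZ u by rewrite daddv_pi_add// XZV memvf.
have decW u : daddv_pi X W u + pW u = u by rewrite daddv_pi_add// XWV memvf.
have mX u : pX u \in X by exact: memv_pi.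
have mZ' u : pZ u \in Z by exact: memv_pi.
have mW' u : pW u \in W by exact: memv_pi.
have pZX u : u \in X -> pZ u = 0.
  move=> uX; apply: (dis X Z) => //.
  rewrite (_ : pZ u = u - pX u) ?memvB//.
  by rewrite {2}(dec u); vec.
have pXZ u : u \in Z -> pX u = 0.
  move=> uZ; apply: (dis X Z) => //.
  rewrite (_ : pX u = u - pZ u) ?memvB//.
  by rewrite {2}(dec u); vec.
have pZW u : pZ (pW u) = pZ u.
  rewrite -[in RHS](decW u) linearD /= (pZX (daddv_pi X W u)) ?add0r//.
  exact: memv_pi.
pose v (y' : K) := pW (fY y').
pose p (u : ((((K * K) * (K * K)) * K)%type)) : V :=
  pX (fY u.1.1.2 + 2^-1 *: fW u.1.2.2 + 2^-1 *: v u.2).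
pose q (u : ((((K * K) * (K * K)) * K)%type)) : V := pZ (fW u.1.2.2 - v u.2).
(* The change of variables behind the identity: [y + y'] is the argument of Q_Z, the pair of [p] and
   [q] that of the hyperbolic term with coefficient 2, and the shifted [x] and [z] that of the other
   one. *)
pose Phi (u : ((((K * K) * (K * K)) * K)%type)) :
    (K * ((K * K) * (K * K)))%type :=
  (u.1.1.2 + u.2,
   (((fX^-1)%VF (p u), (fZ^-1)%VF (q u)),
    (u.1.1.1 - (fX^-1)%VF (pX (fY u.1.1.2 + fW u.1.2.2)),
     u.1.2.1 - (fZ^-1)%VF (pZ (fY u.1.1.2 + fW u.1.2.2))))).
have Phil : linear Phi.
  move=> a [[[x y] [z t]] y'] [[[x1 y1] [z1 t1]] y1'].
  rewrite /Phi /p /q /v /=; congr (_, ((_, _), (_, _))) => /=;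
    rewrite ?(linearD, linearN, linearZ) /=; vec.
have fXK u : u \in X -> fX ((fX^-1)%VF u) = u.
  by move=> uX; rewrite limg_lfunVK// iX.
have fZK u : u \in Z -> fZ ((fZ^-1)%VF u) = u.
  by move=> uZ; rewrite limg_lfunVK// iZ.
have f0 (f : 'Hom(K, V)) x : lker f == 0%VS -> f x = 0 -> x = 0.
  by move=> /lker0P fi fx; apply: fi; rewrite fx linear0.
(* Vanishing of [q] puts [t - v] in both [X] and [W], so [t = v]. With [y' = - y], vanishing of [p]
   gives [y + v = 0], so that [y] lies in both [Y] and [W]. *)
have Phi0 u : Phi u = 0 -> u = 0.
  case: u => -[[x y] [z t]] y'; rewrite /Phi /p /q /v /= => -[] yy' p0 q0 x0 z0.
  have {}p0 : pX (fY y + 2^-1 *: fW t + 2^-1 *: pW (fY y')) = 0.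
    by rewrite -[LHS]fXK// p0 linear0.
  have {}q0 : pZ (fW t - pW (fY y')) = 0 by rewrite -[LHS]fZK// q0 linear0.
  have tv : fW t = pW (fY y').
    apply: subr0_eq; apply: (dis X W) => //; last by rewrite memvB ?(mem_limg iW).
    by rewrite [_ - _]dec q0 addr0.
  have ey : fY y' = - fY y.
    by apply/eqP; rewrite -addr_eq0 addrC -linearD yy' linear0.
  have yv0 : fY y + pW (fY y') = 0.
    have z' : pZ (fY y + pW (fY y')) = 0.
      by rewrite linearD /= pZW ey linearN /= subrr.
    rewrite [LHS]dec z' addr0 -p0 tv; congr (pX _); vec.
  have y0 : y = 0.
    apply: (f0 fY) => //; apply: (dis Y W) => //; first exact: (mem_limg iY _).
    by rewrite -[fY y](addrK (pW (fY y'))) yv0 sub0r memvN.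
  have y'0 : y' = 0 by rewrite -yy' y0 add0r.
  have t0 : t = 0 by apply: (f0 fW) => //; rewrite tv y'0 !linear0.
  move: x0 z0; rewrite y0 t0 y'0 !(linear0, addr0) => -> ->.
  by [].
have Phi_inj : injective Phi.
  move=> u u' uu'; apply: subr0_eq; apply: Phi0.
  by have := Phil (-1) u' u; rewrite !scaleN1r uu' addNr addrC.
have dimP (A B : vectType R) : \dim {:(A * B)%type} = (\dim {:A} + \dim {:B})%N.
  by rewrite !dimvf.
(* The index of one form is computed twice: as a direct sum of Q_Z and [pairing_form], and by
   transport along [Phi] from the direct sum of [four_plane_form] and Q_W. *)
apply: (@inertia_uniq R _ (fun u : (K * ((K * K) * (K * K)))%type =>
   hform w X Z (fY u.1) + pairing_form fX fZ u.2 u.2)); last first.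
  apply: (inertia_sum (q1 := fun y => hform w X Z (fY y))
    (q2 := fun u => pairing_form fX fZ u u)) => //.
    by rewrite /hform !linear0 (bil0l wb).
  exact: bil0l pairing_form_linear _.
apply: (inertia_transport Phil Phi_inj _ _ (q := fun u =>
   four_plane_form fX fY fZ fW u.1 u.1 + hform w X W (fY u.2))); last first.
- apply: (inertia_sum (q1 := fun u => four_plane_form fX fY fZ fW u u)
    (q2 := fun y => hform w X W (fY y))) => //;
    last by rewrite /hform !linear0 (bil0l wb).
  exact: bil0l four_plane_form_linear _.
- move=> [[[x y] [z t]] y'].
  have fXB a u : u \in X -> fX (a - (fX^-1)%VF u) = fX a - u.
    by move=> uX; rewrite linearB /= fXK.
  have fZB a u : u \in Z -> fZ (a - (fZ^-1)%VF u) = fZ a - u.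
    by move=> uZ; rewrite linearB /= fZK.
  have wdd x1 z1 x2 z2 : x1 \in X -> x2 \in X -> z1 \in Z -> z2 \in Z ->
      w (x1 + z1) (x2 + z2) = w x1 z2 - w x2 z1.
    move=> x1X x2X z1Z z2Z; rewrite (bilDl wb) !(bilDr wb) (X0 x1X x2X).
    by rewrite (Z0 z1Z z2Z) add0r addr0 (symplectic_anti z1).
  have wXd x1 x2 z2 : x1 \in X -> x2 \in X -> w x1 (x2 + z2) = w x1 z2.
    by move=> x1X x2X; rewrite (bilDr wb) (X0 x1X x2X) add0r.
  have wdZ x1 z1 z2 : z1 \in Z -> z2 \in Z -> w (x1 + z1) z2 = w x1 z2.
    by move=> z1Z z2Z; rewrite (bilDl wb) (Z0 z1Z z2Z) addr0.
  rewrite /hform /pairing_form /four_plane_form /four_plane_bilin /pairing_bilin /=.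
  rewrite fXB// fZB// fXK ?mX// fZK ?mZ'// linearD /= -/pZ -/pW.
  rewrite /p /q /v /= !(linearD, linearN, linearZ) /= pZW.
  (* The pairings of [y] with [y'] and of [t] with [v] vanish. Expanded along [X + Z], they are the
     two relations that the closing linear arithmetic uses. *)
  have hY := Y0 (mem_limg iY y) (mem_limg iY y').
  have hW := W0 (mem_limg iW t) (mW' (fY y')).
  rewrite (dec (fY y)) (dec (fY y')) wdd// in hY.
  rewrite (dec (fW t)) (dec (pW (fY y'))) pZW wdd// in hW.
  have xX := mem_limg iX x; have zZ := mem_limg iZ z.
  have T1 : w (fX x) (fY y) = w (fX x) (pZ (fY y)).
    by rewrite {1}(dec (fY y)) wXd.
  have T2 : w (fX x) (fW t) = w (fX x) (pZ (fW t)).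
    by rewrite {1}(dec (fW t)) wXd.
  have T3 : w (fY y) (fW t) =
      w (pX (fY y)) (pZ (fW t)) - w (pX (fW t)) (pZ (fY y)).
    by rewrite {1}(dec (fY y)) {1}(dec (fW t)) wdd.
  have T4 : w (fY y) (fZ z) = w (pX (fY y)) (fZ z).
    by rewrite {1}(dec (fY y)) wdZ.
  have T5 : w (fW t) (fZ z) = w (pX (fW t)) (fZ z).
    by rewrite {1}(dec (fW t)) wdZ.
  have T6 : w (pW (fY y')) (fY y') =
      w (pX (pW (fY y'))) (pZ (fY y')) - w (pX (fY y')) (pZ (fY y')).
    by rewrite {1}(dec (pW (fY y'))) pZW {3}(dec (fY y')) wdd.
  have T7 : w (pZ (fY y) + pZ (fY y')) (fY y + fY y') =
      - w (pX (fY y) + pX (fY y')) (pZ (fY y) + pZ (fY y')).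
    have -> : fY y + fY y' = pX (fY y) + pX (fY y') + (pZ (fY y) + pZ (fY y')).
      by rewrite addrACA -!dec.
    have := wdd 0 (pZ (fY y) + pZ (fY y')) (pX (fY y) + pX (fY y')).
    move=> /(_ (pZ (fY y) + pZ (fY y'))); rewrite add0r (bil0l wb) sub0r.
    by apply; rewrite ?mem0v// memvD.
  rewrite T1 T2 T3 T4 T5 T6 T7.
  move: (pX (fY y)) (pX (fY y')) (pX (fW t)) (pX (pW (fY y'))) (fX x) hY hW
    => a1 c1 b1 v1 x1.
  move: (pZ (fY y)) (pZ (fY y')) (pZ (fW t)) (fZ z) => a2 c2 b2 z2 hY hW.
  rewrite !(bilDl wb, bilDr wb, bilNl wb, bilNr wb, bilZl wb, bilZr wb).
  by lra.
- by rewrite !dimP; lia.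
Qed.

End Forms.
End HormanderIdentity.

(** * Local constancy of the Hörmander index *)

Section HormanderIndex.
Context {R : realType}.

Lemma lagrangian_addv (V : vectType R) (w : V -> V -> R) (A B : lagrangian w) :
  (A :&: B = 0)%VS -> (A + B = fullv)%VS.
Proof.
move=> AB; apply/eqP; rewrite eqEdim subvf dimv_disjoint_sum//=.
by have := plane_dim A; have := plane_dim B; lia.
Qed.

(** Isotropy of [X], [Y] and [Z] makes [w (daddv_pi Z X u) v] symmetric on [Y], and the projection
    along [X] kills [X :&: Y], so [ind_inertia] applies. *)
Lemma hform_inertia (K V : vectType R) (w : V -> V -> R) (X Y Z : lagrangian w)
    (f : 'Hom(K, V)) :
  symplectic_form w -> transverse Z X -> lker f == 0%VS -> limg f = Y ->
  inertia (fun t => hform w X Z (f t)) (ind (hform w X Z) Y (X :&: Y)).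
Proof.
move=> ws ZX f0 fY; have wb := symplectic_bilin ws.
have dec u : daddv_pi Z X u + daddv_pi X Z u = u.
  by rewrite daddv_pi_add// lagrangian_addv ?memvf.
apply: (@ind_inertia _ _ _ (fun u v => w (daddv_pi Z X u) v)) => //.
- split=> [u|v] a s t; first by rewrite (bilDr wb) (bilZr wb).
  by rewrite linearP (bilDl wb) (bilZl wb).
- have ZZ a b : w (daddv_pi Z X a) (daddv_pi Z X b) = 0.
    by apply: (@plane_isotropic _ _ _ Z); exact: memv_pi.
  have XX a b : w (daddv_pi X Z a) (daddv_pi X Z b) = 0.
    by apply: (@plane_isotropic _ _ _ X); exact: memv_pi.
  have wZ a b : w (daddv_pi Z X a) b = w (daddv_pi Z X a) (daddv_pi X Z b).
    by rewrite -{1}(dec b) (bilDr wb) ZZ add0r.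
  move=> u v uY vY; have := plane_isotropic uY vY.
  have wX : w (daddv_pi X Z u) v = w (daddv_pi X Z u) (daddv_pi Z X v).
    by rewrite -{1}(dec v) (bilDr wb) XX addr0.
  rewrite -{1}(dec u) (bilDl wb) wX (wZ u v) (wZ v u).
  by rewrite (symplectic_anti ws (daddv_pi X Z u)); lra.
- exact: capvSr.
- move=> u v /memv_capP[uX _] _.
  suff -> : daddv_pi Z X u = 0 by rewrite (bil0l wb).
  apply/eqP; rewrite -memv0 -ZX memv_cap memv_pi /=.
  have -> : daddv_pi Z X u = u - daddv_pi X Z u by rewrite -{2}(dec u) addrK.
  by rewrite memvB ?memv_pi.
Qed.

(** The ambient space varies with the point, so the planes are parametrized by a fixed [K] and
    continuity is stated for the real-valued pairings alone. These determine the two families of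
    forms on powers of [K] to which [inertia_near] applies. *)
Lemma hormander_index_near (T : topologicalType) (x0 : T) (K : vectType R)
    (V : T -> vectType R) (w : forall x, V x -> V x -> R)
    (X Y Z W : forall x, lagrangian (w x))
    (fX fY fZ fW : forall x, 'Hom(K, V x)) :
  (forall x, symplectic_form (w x)) ->
  (\forall x \near x0, [/\ transverse (Z x) (X x), transverse (Z x) (Y x),
     transverse (W x) (X x) & transverse (W x) (Y x)]) ->
  (\forall x \near x0, lker (fX x) == 0%VS /\ limg (fX x) = X x) ->
  (\forall x \near x0, lker (fY x) == 0%VS /\ limg (fY x) = Y x) ->
  (\forall x \near x0, lker (fZ x) == 0%VS /\ limg (fZ x) = Z x) ->
  (\forall x \near x0, lker (fW x) == 0%VS /\ limg (fW x) = W x) ->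
  let pairing_cont f g := forall s t,
    (fun x => w x (f x s) (g x t)) @ x0 --> w x0 (f x0 s) (g x0 t) in
  pairing_cont fX fY -> pairing_cont fX fZ -> pairing_cont fX fW ->
  pairing_cont fY fZ -> pairing_cont fY fW -> pairing_cont fW fZ ->
  \forall x \near x0, hormander_index (w x) (X x) (Y x) (Z x) (W x) =
    hormander_index (w x0) (X x0) (Y x0) (Z x0) (W x0).
Proof.
move=> ws tr nX nY nZ nW pc cXY cXZ cXW cYZ cYW cWZ.
have fullE x (A B : lagrangian (w x)) : transverse A B -> (B + A = fullv)%VS.
  by move=> AB; rewrite addvC lagrangian_addv.
have capE (x : T) (A B : {vspace V x}) : transverse A B -> (B :&: A = 0)%VS.
  by rewrite /transverse capvC.
have iso x (A : lagrangian (w x)) : isotropic (w x) A.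
  by move=> u v uA vA; exact: plane_isotropic uA vA.
have [r nr] : exists r, \forall x \near x0, inertia (fun u =>
    four_plane_form (w x) (fX x) (fY x) (fZ x) (fW x) u u) r.
  apply: (inertia_near (B := fun x u v =>
      four_plane_form (w x) (fX x) (fY x) (fZ x) (fW x) u v)) => [x|x u v|u v|u].
  - exact: four_plane_form_linear.
  - by rewrite /four_plane_form addrC.
  - rewrite /four_plane_form /four_plane_bilin.
    apply: cvgM; last exact: cvg_cst.
    by apply: cvgN; repeat (first [apply: cvgD | apply: cvgB]);
      first [exact: cXY|exact: cXW|apply: cvgN; exact: cXZ|exact: cYW|
        exact: cYZ|exact: cWZ].
  - have [kX iX] := nbhs_singleton nX; have [kY iY] := nbhs_singleton nY.
    have [kZ iZ] := nbhs_singleton nZ; have [kW iW] := nbhs_singleton nW.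
    have [tZX tZY tWX tWY] := nbhs_singleton tr.
    apply: (four_plane_form_nondegenerate (ws x0) (iso _ (X x0)) (iso _ (Y x0))
      (iso _ (Z x0)) (iso _ (W x0))); rewrite ?fullE ?capE//.
have [h nh] : exists h, \forall x \near x0, inertia (fun u =>
    pairing_form (w x) (fX x) (fZ x) u u) h.
  apply: (inertia_near (B := fun x u v =>
      pairing_form (w x) (fX x) (fZ x) u v)) => [x|x u v|u v|u].
  - exact: pairing_form_linear.
  - by rewrite /pairing_form addrC.
  - rewrite /pairing_form /pairing_bilin.
    apply: cvgM; last exact: cvg_cst.
    apply: cvgN; apply: cvgD; apply: cvgB; try exact: cXZ;
      by rewrite mulr2n; under eq_fun do rewrite mulr2n; apply: cvgD; exact: cXZ.
  - have [kX iX] := nbhs_singleton nX.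
    have [kZ iZ] := nbhs_singleton nZ.
    have [tZX tZY tWX tWY] := nbhs_singleton tr.
    apply: (pairing_form_nondegenerate (ws x0) (iso _ (X x0)) 
      (iso _ (Z x0)) ); rewrite ?fullE ?capE//.
(* Wherever both indices have their locally constant values [r] and [h], the identity gives the
   Hörmander index as [h - r]. *)
have idx x : [/\ transverse (Z x) (X x), transverse (Z x) (Y x),
     transverse (W x) (X x) & transverse (W x) (Y x)] ->
  lker (fX x) == 0%VS /\ limg (fX x) = X x ->
  lker (fY x) == 0%VS /\ limg (fY x) = Y x ->
  lker (fZ x) == 0%VS /\ limg (fZ x) = Z x ->
  lker (fW x) == 0%VS /\ limg (fW x) = W x ->
  inertia (fun u => four_plane_form (w x) (fX x) (fY x) (fZ x) (fW x) u u) r ->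
  inertia (fun u => pairing_form (w x) (fX x) (fZ x) u u) h ->
  hormander_index (w x) (X x) (Y x) (Z x) (W x) = h%:Z - r%:Z.
  move=> [tZX tZY tWX tWY] [kX iX] [kY iY] [kZ iZ] [kW iW] ir ih.
  have iHZ := hform_inertia (ws x) tZX kY iY.
  have iHW := hform_inertia (ws x) tWX kY iY.
  have := inertia_identity (ws x) (iso _ (X x)) (iso _ (Y x)) (iso _ (Z x))
    (iso _ (W x)) (capE _ _ _ tZX) (fullE _ _ _ tZX) (capE _ _ _ tWX)
    (fullE _ _ _ tWX) (capE _ _ _ tWY) kX iX kY iY kZ iZ kW iW ir ih iHZ iHW.
  by rewrite /hormander_index; lia.
rewrite (idx x0 (nbhs_singleton tr) (nbhs_singleton nX) (nbhs_singleton nY)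
  (nbhs_singleton nZ) (nbhs_singleton nW) (nbhs_singleton nr)
  (nbhs_singleton nh)).
by near=> x; apply: idx; near: x.
Unshelve. all: by end_near. Qed.

End HormanderIndex.

(** * Symplectic bases and coordinate planes *)

Section SymplecticBasis.
Context {R : realType} {V : vectType R} {n : nat}.

Definition comb_fun (g : 'I_n -> V) (t : 'rV[R]_n) : V := \sum_k t 0 k *: g k.

Fact comb_linear g : linear (comb_fun g).
Proof.
move=> a s t; rewrite scaler_sumr -big_split /=; apply: eq_bigr => k _.
by rewrite !mxE scalerDl scalerA.
Qed.

HB.instance Definition _ g :=
  GRing.isLinear.Build R 'rV[R]_n V *:%R (comb_fun g) (comb_linear g).

Definition comb (g : 'I_n -> V) : 'Hom('rV[R]_n, V) := linfun (comb_fun g).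

Lemma combE g t : comb g t = \sum_k t 0 k *: g k.
Proof. by rewrite lfunE. Qed.

Lemma comb_delta g k : comb g (delta_mx 0 k) = g k.
Proof.
rewrite combE (bigD1 k)//= big1 ?addr0 => [|j jk].
  by rewrite mxE !eqxx scale1r.
by rewrite mxE (negPf jk) andbF scale0r.
Qed.

Lemma limg_comb g : limg (comb g) = <<[seq g k | k : 'I_n]>>%VS.
Proof.
apply/eqP; rewrite eqEsubv; apply/andP; split.
  apply/subvP => _ /memv_imgP[t _ ->]; rewrite combE.
  by apply: memv_suml => k _; rewrite memvZ// memv_span// fintype.image_f.
apply/span_subvP => _ /fintype.imageP[k _ ->].
by rewrite -comb_delta memv_img ?memvf.
Qed.

Lemma mem_span_comb (g : 'I_n -> V) k : g k \in <<[seq g k | k : 'I_n]>>%VS.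
Proof. by rewrite memv_span// fintype.image_f. Qed.

Lemma mem_span_combP (g : 'I_n -> V) v : v \in <<[seq g k | k : 'I_n]>>%VS ->
  exists t : 'rV[R]_n, v = \sum_k t 0 k *: g k.
Proof. by rewrite -limg_comb => /memv_imgP[t _ ->]; exists t; rewrite combE. Qed.

(** Pairing with [h k] reads off the coefficient of [g k] in a combination. *)
Lemma comb_inj (w : V -> V -> R) (g h : 'I_n -> V) : bilin w ->
  (forall j k, w (g j) (h k) = (j == k)%:R) -> lker (comb g) == 0%VS.
Proof.
move=> wb gh; apply/eqP/eqP; rewrite -subv0; apply/subvP => t.
rewrite memv_ker memv0 => /eqP t0; apply/eqP/rowP => k; rewrite mxE.
have := bil0l wb (h k); rewrite -t0 combE (bil_suml wb) (bigD1 k)//= big1.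
  by rewrite (bilZl wb) gh eqxx mulr1 addr0.
by move=> j jk; rewrite (bilZl wb) gh (negPf jk) mulr0.
Qed.

Lemma dim_comb g : lker (comb g) == 0%VS ->
  \dim <<[seq g k | k : 'I_n]>>%VS = n.
Proof.
move=> g0; rewrite -limg_comb limg_dim_eq ?(eqP g0) ?capv0//.
by rewrite dimvf /dim /= mul1n.
Qed.

Lemma comb_limg g (L : {vspace V}) : lker (comb g) == 0%VS ->
  (forall k, g k \in L) -> \dim L = n -> limg (comb g) = L.
Proof.
move=> g0 gL dL; apply/eqP; rewrite eqEdim limg_comb dim_comb// dL leqnn andbT.
by apply/span_subvP => _ /fintype.imageP[k _ ->].
Qed.

Variables (w : V -> V -> R) (e f : 'I_n -> V).
Hypotheses (ws : symplectic_form w)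
  (ff : forall j k, w (f j) (f k) = 0)
  (ef : forall j k, w (e j) (f k) = (j == k)%:R).
Let wb := symplectic_bilin ws.
Let F : {vspace V} := <<[seq f k | k : 'I_n]>>%VS.

(** Take [J] minimal such that [L :&: F] and the [f j], [j] in [J], span [F]; the sum is then
    direct. A vector of [L] in the coordinate plane is orthogonal to [L] and to these [f j], hence
    to [F], so it has no [e] component. It thus lies in both summands. *)
Lemma coordinate_transverse (L : lagrangian w) : exists J : {set 'I_n},
  transverse L <<[seq (if k \in J then f k else e k) | k : 'I_n]>>%VS.
Proof.
pose K := (L :&: F)%VS.
pose FJ (J : {set 'I_n}) := (\sum_(j in J) <[f j]>)%VS.
pose P (J : {set 'I_n}) := (F <= K + FJ J)%VS.
have PT : P [set: 'I_n]%SET.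
  apply: subv_trans (addvSr _ _); apply/span_subvP => _ /fintype.imageP[k _ ->].
  by rewrite memvE; apply: sumv_sup (subvv _).
case: (arg_minnP (fun J : {set 'I_n} => #|J|) PT) => J PJ Jmin.
have FJF : (FJ J <= F)%VS.
  by apply/subv_sumP => j _; rewrite -memvE mem_span_comb.
have KJ : (K :&: FJ J = 0)%VS.
  apply/eqP; rewrite -subv0; apply/subvP => v /memv_capP[vK].
  move=> /memv_sumP[u uE vE]; rewrite memv0; apply/negPn/negP => v0.
  have [j jJ uj] : exists2 j, j \in J & u j != 0.
    apply/exists_inP; apply: contraNT v0 => /exists_inPn u0.
    by rewrite vE big1// => j jJ; apply/eqP/negPn; exact: u0.
  have /vlineP[c ujE] := uE j jJ.
  have c0 : c != 0 by apply: contraNneq uj => c0; rewrite ujE c0 scale0r.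
  (* The vector [v] of [K] involves [f j], so [f j] can be expressed by [v] and the other
     generators; [j] could be dropped from [J]. *)
  suff /Jmin : P (J :\ j) by rewrite (cardsD1 j J) jJ ltnn.
  apply: (subv_trans PJ); rewrite subv_add addvSl /=.
  apply/subv_sumP => i iJ; have [->|ij] := eqVneq i j; last first.
    apply: subv_trans (addvSr _ _); apply: (sumv_sup i) => //.
    by rewrite !inE ij.
  rewrite -memvE; apply/memv_addP; exists (c^-1 *: v); first by rewrite memvZ.
  exists (- (c^-1 *: \sum_(i in J :\ j) u i)).
    rewrite memvN memvZ//; apply: memv_sumr => k; rewrite !inE => /andP[_].
    exact: uE.
  rewrite -scalerBr vE (big_setD1 j)//= addrK ujE scalerA mulVf// scale1r//.
exists J; apply/eqP; rewrite -subv0; apply/subvP => v /memv_capP[vL].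
move=> /mem_span_combP[t vE].
have vJ j : j \in J -> w v (f j) = 0.
  move=> jJ; rewrite vE (bil_suml wb) big1// => k _; rewrite (bilZl wb).
  case: ifPn => [_|kJ]; first by rewrite ff mulr0.
  by rewrite ef; case: eqP kJ => [->|]; rewrite ?jJ// mulr0.
have vF i : w v (f i) = 0.
  have : f i \in (K + FJ J)%VS by rewrite (subvP PJ)// mem_span_comb.
  case/memv_addP => k /memv_capP[kL _] [_ /memv_sumP[u uE ->] ->].
  rewrite (bilDr wb) (plane_isotropic vL kL) add0r (bil_sumr wb) big1// => j jJ.
  by have /vlineP[c ->] := uE j jJ; rewrite (bilZr wb) vJ// mulr0.
have t0 i : i \notin J -> t 0 i = 0.
  move=> iJ; have := vF i; rewrite vE (bil_suml wb) (bigD1 i)//= big1.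
    by rewrite (negPf iJ) (bilZl wb) ef eqxx mulr1 addr0.
  move=> k ki; rewrite (bilZl wb); case: ifPn => _; first by rewrite ff mulr0.
  by rewrite ef (negPf ki) mulr0.
have vFJ : v \in FJ J.
  have -> : v = \sum_(j in J) t 0 j *: f j.
    rewrite vE [RHS]big_mkcond; apply: eq_bigr => k _.
    by case: ifPn => // kJ; rewrite t0 ?scale0r.
  by apply: memv_sumr => j jJ; rewrite memvZ// memv_line.
by rewrite -KJ !memv_cap vL vFJ (subvP FJF).
Qed.

End SymplecticBasis.

(** * Continuity of smooth maps *)

Section Smooth.
Context {R : realType}.

(* No differentiability is needed: where the limit defining ['D_v g x] does not
   exist, both sides are the default limit, which is [0] in ['rV[R]_d]. *)
Lemma derive_opp (V : normedModType R) d (g : V -> 'rV[R]_d) (v : V) :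
  'D_v (fun x => - g x) = (fun x => - 'D_v g x).
Proof.
apply/funext => x.
have [dg|ndg] := pselect (derivable g x v); first exact: deriveN.
have ndNg : ~ derivable (fun x => - g x) x v.
  move=> /derivableN dNg; apply: ndg.
  by rewrite (_ : g = fun y => - - g y)//; apply/funext => y; rewrite opprK.
have pt0 : (point : ('rV[R]_d : normedModType R)) = 0.
  by apply/rowP => i; rewrite !mxE.
by rewrite /derive (dvgP ndg) (dvgP ndNg) pt0 oppr0.
Qed.

Lemma Ck_opp (V : normedModType R) d k (O : set V) (g : V -> 'rV[R]_d) :
  Ck k O g -> Ck k O (fun x => - g x).
Proof.
elim: k g => [|k IH] g /= gk.
  by move=> x Ox; apply: continuousN; exact: gk.
move=> v; have [gd gD] := gk v; split=> [x Ox|].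
  by apply: derivableN; exact: gd.
by rewrite derive_opp; exact: IH.
Qed.

Lemma smooth_mx_opp (M : atlas R) (A : set M) p q (g h : M -> 'M[R]_(p, q)) :
  (forall m, A m -> h m = - g m) -> smooth_mx A g -> smooth_mx A h.
Proof.
move=> hg gs x Ax; have [i [j [U [Uo Ux UA Uj [k kC kE]]]]] := gs x Ax.
exists i, j, U; split => //; exists (fun x => - k x) => [l|y Uy]; first exact: Ck_opp.
have Ay : A y by have [] := UA y Uy.
rewrite /= (hg y Ay) linearN /=; congr (- _); exact: kE.
Qed.

Lemma chart_opens_open (M : atlas R) (U : set M) : chart_opens U -> open U.
Proof.
move=> cU; exists [set U]; last by rewrite bigcup_set1.
by move=> _ ->; exact: (@finI_from1 _ _ (@chart_opens R M) id).
Qed.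

Lemma atlas_continuous (T : topologicalType) (M : atlas R) (f : T -> M) :
  (forall U, chart_opens U -> open (f @^-1` U)) -> continuous f.
Proof.
move=> fo; apply/continuousP => _ [D' D'sub <-].
rewrite preimage_bigcup; apply: bigcup_open => B /D'sub [E Esub <-].
rewrite preimage_bigcap bigcap_fset big_seq; elim/big_ind: _ => //.
- exact: openT.
- exact: openI.
- by move=> U /Esub/set_mem; exact: fo.
Qed.

Lemma coord_cvg (M : atlas R) (i : chart M) (x : M) :
  dom i x -> Defs.coord i y @[y --> x] --> Defs.coord i x.
Proof.
move=> ix O; rewrite nbhsE => -[B [oB Bx] BO].
have oU : open (dom i `&` Defs.coord i @^-1` B : set M).
  by apply: chart_opens_open; exists i, B.
apply: filterS (open_nbhs_nbhs (conj oU (conj ix Bx))) => y [_ By].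
exact: BO.
Qed.

Lemma smooth_on_cvg (M N : atlas R) (A : set M) (f : M -> N) (x : M) :
  smooth_on A f -> A x -> exists j : chart N,
    (\forall y \near x, dom j (f y)) /\
    Defs.coord j (f y) @[y --> x] --> Defs.coord j (f x).
Proof.
move=> fs Ax; have [i [j [U [Uo Ux UA Uj [g gC gE]]]]] := fs x Ax.
have nU : \forall y \near x, U y by exact: open_nbhs_nbhs.
exists j; split; first by apply: filterS nU => y /Uj.
rewrite gE//.
have [_ ix] := UA x Ux.
(* Order 0 of [Cinfty] is continuity of the local representative. *)
have gx : {for Defs.coord i x, continuous g} by apply: (gC 0%N); exists x.
apply: cvg_trans (cvg_comp _ _ (coord_cvg ix) gx).
apply: (@near_eq_cvg _ _ (nbhs x)); near=> y; rewrite /= gE//; near: y; exact: nU.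
Unshelve. all: by end_near. Qed.

Lemma smooth_mx_cvg (M : atlas R) (A : set M) p q (g : M -> 'M[R]_(p, q))
    (x : M) a b :
  smooth_mx A g -> A x -> g y a b @[y --> x] --> g x a b.
Proof.
move=> gs Ax; have [j [_ gc]] := smooth_on_cvg gs Ax.
have gE y : g y a b = mxvec (g y) 0 (mxvec_index a b) by rewrite mxvecE.
under eq_fun do rewrite gE; rewrite gE.
exact: (cvg_comp _ _ gc (@coord_continuous R _ _ _ _ _)).
Qed.

End Smooth.

(** * Charts of L(E) *)

Section Frames.
Context {R : realType} {M : atlas R} {n : nat} {E : bundle M n}.
Hypotheses
  (ws : forall m, symplectic_form (@Defs.form R M n E m))
  (tl : forall i m, triv_dom i m -> linear (@triv R M n E i m)).

Lemma frame_comb_inj (F : frame E) m :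
  fr_dom F m -> lker (comb (fr_f F m)) == 0%VS.
Proof.
move=> Fm.
apply: (@comb_inj _ _ _ (fun u v => Defs.form v u) _ (fr_e F m)).
  by split; [exact: form_linear_l|exact: form_linear_r].
by move=> j k; rewrite fr_ef// eq_sym.
Qed.

Lemma trivN i m (u : fib E m) : triv_dom i m -> triv i (- u) = - triv i u.
Proof.
move=> im; have t0 : triv i (0 : fib E m) = 0.
  by have := tl im (-1) 0 0; rewrite scaler0 addr0 scaleN1r addNr.
by have := tl im (-1) u 0; rewrite !scaleN1r !addr0 t0 addr0.
Qed.

(** For [k] outside [J] the pair [(e_k, f_k)] is replaced by [(- f_k, e_k)]; the sign keeps the
    basis symplectic. The new frame gives a chart of L(E) around [L]. *)
Lemma frame_transverse (F : frame E) (m : M) (L : lag E m) : fr_dom F m ->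
  exists F' : frame E, fr_dom F' m /\ transverse L (fr_span F' m).
Proof.
move=> Fm.
have [J JL] := coordinate_transverse (ws m) (fun j k => fr_ff j k Fm)
  (fun j k => fr_ef j k Fm) L.
pose e' m' k : fib E m' := if k \in J then fr_e F m' k else - fr_f F m' k.
pose f' m' k : fib E m' := if k \in J then fr_f F m' k else fr_e F m' k.
have e's k i : smooth_mx (fr_dom F `&` triv_dom i) (fun m => triv i (e' m k)).
  rewrite /e'; case: (k \in J); first exact: fr_e_smooth.
  by apply: (smooth_mx_opp _ (@fr_f_smooth _ _ _ _ F k i)) => m' [_ im']; exact: trivN.
have f's k i : smooth_mx (fr_dom F `&` triv_dom i) (fun m => triv i (f' m k)).
  by rewrite /f'; case: (k \in J); [exact: fr_f_smooth|exact: fr_e_smooth].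
have fe m' j k : fr_dom F m' ->
    Defs.form (fr_f F m' j) (fr_e F m' k) = - (j == k)%:R.
  by move=> Fm'; rewrite (symplectic_anti (ws m')) fr_ef// eq_sym.
have wb m' := symplectic_bilin (ws m').
have JE j k : (j \in J) != (k \in J) -> (j == k) = false.
  by apply: contraNF => /eqP ->.
have e'e' m' j k : fr_dom F m' -> Defs.form (e' m' j) (e' m' k) = 0.
  move=> Fm'; rewrite /e'; case: ifP => jJ; case: ifP => kJ;
    rewrite ?(bilNl (wb m')) ?(bilNr (wb m')) ?fr_ee ?fr_ff ?fr_ef ?fe ?oppr0//.
    by rewrite JE ?jJ ?kJ// oppr0.
  by rewrite JE ?jJ ?kJ// !oppr0.
have f'f' m' j k : fr_dom F m' -> Defs.form (f' m' j) (f' m' k) = 0.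
  move=> Fm'; rewrite /f'; case: ifP => jJ; case: ifP => kJ;
    rewrite ?fr_ee ?fr_ff ?fr_ef ?fe//.
    by rewrite JE ?jJ ?kJ// oppr0.
  by rewrite JE ?jJ ?kJ.
have e'f' m' j k : fr_dom F m' -> Defs.form (e' m' j) (f' m' k) = (j == k)%:R.
  move=> Fm'; rewrite /e' /f'; case: ifP => jJ; case: ifP => kJ;
    rewrite ?(bilNl (wb m')) ?fr_ee ?fr_ff ?fr_ef ?fe ?oppr0 ?opprK//.
    by rewrite JE ?jJ ?kJ.
  by rewrite JE ?jJ ?kJ.
by exists (Frame (fr_open F) e's f's e'e' f'f' e'f').
Qed.

Lemma dim_fib i m : triv_dom i m -> bijective (@triv R M n E i m) ->
  \dim {:fib E m} = (n + n)%N.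
Proof.
move=> im [g gK Kg].
pose h : {linear fib E m -> 'rV[R]_(n + n)} :=
  HB.pack (@triv R M n E i m) (GRing.isLinear.Build _ _ _ _ _ (tl im)).
have hE u : linfun h u = triv i u by rewrite lfunE.
have h0 : lker (linfun h) == 0%VS.
  by apply/lker0P => u v; rewrite !hE; exact: (can_inj gK).
have <- : \dim (limg (linfun h)) = \dim {:fib E m}.
  by rewrite limg_dim_eq// (eqP h0) capv0.
have -> : limg (linfun h) = fullv.
  apply/eqP; rewrite eqEsubv subvf /=; apply/subvP => v _.
  by rewrite -[v]Kg -hE memv_img ?memvf.
by rewrite dimvf /dim /= mul1n.
Qed.

(** The vector [g j] is the projection of [e_j] onto [L] along [F]: the two differ by an element of
    [F], whose coefficients are recovered by pairing with the [e_k]. The [g j] are dual to the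
    [f_k], hence independent, and isotropy of [L] makes the matrix symmetric. *)
Lemma lag_frame_basis (F : frame E) (m : M) (L : lag E m) :
  \dim {:fib E m} = (n + n)%N -> fr_dom F m -> transverse L (fr_span F m) ->
  let g j := fr_e F m j + \sum_k lag_mx F L j k *: fr_f F m k in
  [/\ lker (comb g) == 0%VS, limg (comb g) = L &
    forall j k, lag_mx F L j k = lag_mx F L k j].
Proof.
move=> dimE Fm LF g; have wb := symplectic_bilin (ws m).
have dL : \dim L = n by have := plane_dim L; rewrite dimE; lia.
have dF : \dim (fr_span F m) = n by rewrite dim_comb// frame_comb_inj.
have LFV : (L + fr_span F m = fullv)%VS.
  by apply/eqP; rewrite eqEdim subvf dimv_disjoint_sum// dL dF dimE leqnn.
have gE j : daddv_pi L (fr_span F m) (fr_e F m j) = g j.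
  set b := daddv_pi _ _ _.
  have /mem_span_combP[t tE] : b - fr_e F m j \in fr_span F m.
    rewrite -[X in b - X](daddv_pi_add LF) ?LFV ?memvf// opprD addrA subrr sub0r.
    by rewrite memvN memv_pi.
  have bE : b = fr_e F m j + \sum_k t 0 k *: fr_f F m k by rewrite -tE addrC subrK.
  rewrite {1}bE; congr (_ + _); apply: eq_bigr => k _; congr (_ *: _).
  rewrite mxE -/b bE (bilDr wb) fr_ee// add0r (bil_sumr wb) (bigD1 k)//= big1.
    by rewrite (bilZr wb) fr_ef// eqxx mulr1 addr0.
  by move=> i ik; rewrite (bilZr wb) fr_ef// eq_sym (negPf ik) mulr0.
have gL j : g j \in plane L by rewrite -gE memv_pi.
have gf j k : Defs.form (g j) (fr_f F m k) = (j == k)%:R.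
  rewrite (bilDl wb) fr_ef// (bil_suml wb) big1 ?addr0// => i _.
  by rewrite (bilZl wb) fr_ff// mulr0.
have g0 := comb_inj wb gf.
split=> //; first exact: comb_limg.
move=> j k; have := plane_isotropic (gL j) (gL k).
rewrite {2}/g (bilDr wb) (bil_sumr wb) (bigD1 j)//= big1 => [|i ij].
  rewrite (bilZr wb) gf eqxx mulr1 addr0 (symplectic_anti (ws m)).
  by rewrite [Defs.form (fr_e F m k) (g j)](_ : _ = lag_mx F L j k) ?mxE ?gE//; lra.
by rewrite (bilZr wb) gf eq_sym (negPf ij) mulr0.
Qed.

End Frames.

(* Instances at a point: unification does not find the filter of neighbourhoods
   in [space M] when the general lemmas are applied. *)
Lemma cvg_sum_at (R : realType) (T : topologicalType) (x0 : T) (I : Type)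
    (r : seq I) (f : I -> T -> R) :
  (forall i, f i x @[x --> x0] --> f i x0) ->
  \sum_(i <- r) f i x @[x --> x0] --> \sum_(i <- r) f i x0.
Proof.
move=> fc; elim: r => [|i r IH].
  by rewrite big_nil; under eq_fun do rewrite big_nil; exact: cvg_cst.
rewrite big_cons; under eq_fun do rewrite big_cons.
by apply: cvgD.
Qed.

Lemma cvg_eq_at (R : realType) (T : topologicalType) (x0 : T) (f g : T -> R) :
  (\forall x \near x0, f x = g x) -> g x @[x --> x0] --> g x0 ->
  f x @[x --> x0] --> f x0.
Proof.
move=> fg gc; rewrite (nbhs_singleton fg); apply: cvg_trans gc.
apply: (@near_eq_cvg _ _ (nbhs x0)); near=> x; apply/esym; near: x; exact: fg.
Unshelve. all: by end_near. Qed.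

Lemma cvgD_at (R : realType) (T : topologicalType) (x0 : T) (f g : T -> R) :
  f x @[x --> x0] --> f x0 -> g x @[x --> x0] --> g x0 ->
  f x + g x @[x --> x0] --> f x0 + g x0.
Proof. by move=> fc gc; apply: cvgD. Qed.

Lemma cvgM_at (R : realType) (T : topologicalType) (x0 : T) (f g : T -> R) :
  f x @[x --> x0] --> f x0 -> g x @[x --> x0] --> g x0 ->
  f x * g x @[x --> x0] --> f x0 * g x0.
Proof. by move=> fc gc; apply: cvgM. Qed.

Lemma cvg_cst_at (R : realType) (T : topologicalType) (x0 : T) (a : R) :
  (fun=> a) x @[x --> x0] --> a.
Proof. exact: cvg_cst. Qed.

(** * Continuous bases of sections and continuity of the projection *)

Section Sections.
Context {R : realType} {M : atlas R} {n : nat} {E : bundle M n}.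
Hypotheses
  (ws : forall m, symplectic_form (@Defs.form R M n E m))
  (to : forall i : triv_idx E, open (triv_dom i))
  (tc : forall m : M, exists i : triv_idx E, triv_dom i m)
  (ti : forall (i : triv_idx E) (m : M), triv_dom i m ->
    linear (@triv R M n E i m) /\ bijective (@triv R M n E i m)).

Lemma dim_fibre m : \dim {:fib E m} = (n + n)%N.
Proof.
have [i im] := tc m; apply: (dim_fib _ im (proj2 (ti im))).
by move=> j m' /ti[].
Qed.

Lemma triv_comb i m (g : 'I_n -> fib E m) (t : 'rV[R]_n) b : triv_dom i m ->
  triv i (comb g t) 0 b = \sum_j t 0 j * triv i (g j) 0 b.
Proof.
move=> im; have [tl _] := ti im.
pose h : {linear fib E m -> 'rV[R]_(n + n)} :=
  HB.pack (@triv R M n E i m) (GRing.isLinear.Build _ _ _ _ _ tl).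
have hE u : triv i u = h u by [].
rewrite combE hE linear_sum summxE; apply: eq_bigr => j _.
by rewrite linearZ mxE.
Qed.

(** In a chart of L(E) around [S m0] the matrix of [S m] has continuous entries, so the basis given
    by [lag_frame_basis] varies continuously. Continuity is expressed in trivializations, since the
    fibres vary. *)
Lemma section_basis (A : set M) (S : forall m, lag E m) (m0 : M) :
  smooth_section A S -> A m0 ->
  exists fS : forall m, 'Hom('rV[R]_n, fib E m),
    (\forall m \near m0, lker (fS m) == 0%VS /\ limg (fS m) = S m) /\
    forall i, triv_dom i m0 -> forall t b,
      triv i (fS m t) 0 b @[m --> m0] --> triv i (fS m0 t) 0 b.
Proof.
move=> Ss Am0; have [[i' F] [nd cc]] := smooth_on_cvg Ss Am0.
pose g m j := fr_e F m j + \sum_k lag_mx F (S m) j k *: fr_f F m k.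
have Fm0 : fr_dom F m0 by have [] := nbhs_singleton nd.
exists (fun m => comb (g m)); split.
  apply: filterS nd => m [/= _ Fm Sm].
  by have [] := lag_frame_basis ws (dim_fibre m) Fm Sm.
move=> i im0 t b.
have Sc j k : lag_mx F (S m) j k @[m --> m0] --> lag_mx F (S m0) j k.
  (* Only the entries on and above the diagonal are coordinates of the chart; the others follow from
     symmetry, valid near [m0]. *)
  wlog jk : j k / (j <= k)%N.
    move=> H; have [jk|kj] := leqP j k; first exact: H.
    apply: (@cvg_eq_at _ _ _ _ (fun m => lag_mx F (S m) k j)); last exact/H/ltnW.
    apply: filterS nd => m [/= _ Fm Sm].
    by have [_ _] := lag_frame_basis ws (dim_fibre m) Fm Sm.
  have pU : (j, k) \in @upper_entry n by [].
  pose p := rshift (Defs.dim M) (enum_rank_in pU (j, k)).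
  have pE m : lag_mx F (S m) j k =
      @Defs.coord R (LG E) (i', F) (existT (lag E) m (S m) : LG E) 0 p.
    by rewrite /= /p row_mxEr /upper [RHS]mxE enum_rankK_in.
  under eq_fun do rewrite pE; rewrite pE.
  exact: (cvg_comp _ _ cc (@coord_continuous R _ _ _ _ _)).
have ni : \forall m \near m0, triv_dom i m by exact: open_nbhs_nbhs.
apply: (@cvg_eq_at _ _ _ _ (fun m => \sum_j t 0 j * (triv i (fr_e F m j) 0 b +
   \sum_k lag_mx F (S m) j k * triv i (fr_f F m k) 0 b))).
  apply: filterS ni => m im; rewrite triv_comb//; apply: eq_bigr => j _.
  congr (_ * _); have [tl _] := ti im.
  pose h : {linear fib E m -> 'rV[R]_(n + n)} :=
    HB.pack (@triv R M n E i m) (GRing.isLinear.Build _ _ _ _ _ tl).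
  have hE u : triv i u = h u by [].
  rewrite !hE linearD linear_sum mxE summxE; congr (_ + _).
  by apply: eq_bigr => k _; rewrite linearZ mxE.
apply: cvg_sum_at => j; apply: cvgM_at; first exact: cvg_cst_at.
apply: cvgD_at; first by apply: smooth_mx_cvg (@fr_e_smooth _ _ _ _ F j i) _.
apply: cvg_sum_at => k; apply: cvgM_at; first exact: Sc.
by apply: smooth_mx_cvg (@fr_f_smooth _ _ _ _ F k i) _.
Qed.

(** Stated along a map [p] to the base, so that it applies to families of vectors indexed by L(E),
    with [p] the projection. *)
Lemma form_cvg (T : topologicalType) (p : T -> M) (x0 : T) (i : triv_idx E)
    (u v : forall x, fib E (p x)) :
  (exists2 g : M -> 'M[R]_(n + n), smooth_mx (triv_dom i) g &
      forall m (u v : fib E m), triv_dom i m ->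
        Defs.form u v = (triv i u *m g m *m (triv i v)^T) 0 0) ->
  {for x0, continuous p} -> triv_dom i (p x0) ->
  (forall b, triv i (u x) 0 b @[x --> x0] --> triv i (u x0) 0 b) ->
  (forall b, triv i (v x) 0 b @[x --> x0] --> triv i (v x0) 0 b) ->
  Defs.form (u x) (v x) @[x --> x0] --> Defs.form (u x0) (v x0).
Proof.
move=> [g gs gE] pc ix0 uc vc.
have ni : \forall x \near x0, triv_dom i (p x).
  by apply: pc; exact: open_nbhs_nbhs.
apply: (@cvg_eq_at _ _ _ _ (fun x => \sum_b (\sum_a triv i (u x) 0 a *
    g (p x) a b) * triv i (v x) 0 b)).
  apply: filterS ni => x ix; rewrite gE// mxE; apply: eq_bigr => b _.
  by rewrite !mxE.
apply: cvg_sum_at => b; apply: cvgM_at => //.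
apply: cvg_sum_at => a; apply: cvgM_at => //.
have gc := @smooth_mx_cvg _ _ _ _ _ g (p x0) a b gs ix0.
exact: (cvg_comp _ _ pc gc).
Qed.

Lemma LG_proj_continuous (X : forall m, lag E m) :
  smooth_section setT X -> continuous (@LG_proj R M n E).
Proof.
move=> Xs; apply: atlas_continuous => _ [i [O [Oo ->]]].
rewrite openE => x [/= ix Ox].
have [[i' F] [/nbhs_singleton[/= _ Fx _] _]] := smooth_on_cvg Xs (I : setT (LG_proj x)).
have [|F' [F'x xF']] := @frame_transverse _ _ _ _ ws _ F _ (projT2 x) Fx.
  by move=> j m' /ti[].
(* The first block of coordinates in the chart [(i, F')] is that of the base point, so the condition
   given by [O] is open there. *)
pose O' : set 'rV[R]_(Defs.dim (LG E)) := [set v | O (lsubmx v)].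
have oO' : open O'.
  rewrite openE => v /= Ov.
  have /nbhs_ballP[e e0 eO] : nbhs (lsubmx v : 'rV[R]__) O by exact: open_nbhs_nbhs.
  apply/nbhs_ballP; exists e => // u [_ uv]; apply: eO; split => // a b.
  by rewrite !mxE; exact: uv.
pose W : set (LG E) := @dom R (LG E) (i, F') `&` @Defs.coord R (LG E) (i, F') @^-1` O'.
have oW : open W by apply: chart_opens_open; exists (i, F'), O'.
have Wx : W x by split; [split|rewrite /O' /= row_mxKl].
apply: filterS (open_nbhs_nbhs (conj oW Wx)) => y [[/= iy _ _]].
by rewrite /O' /= row_mxKl.
Qed.

End Sections.

(** * The Hormander class *)

(** Bases of the lifted [X], [Y] and [Z] are pulled back from [M] along the continuous projection.
    The section [W] lives on L(E) itself, so its basis comes from [section_basis] for the pulled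
    back bundle. *)
Lemma lifted_hormander_index_near (R : realType) (M : atlas R) (n : nat)
    (E : bundle M n) (X Y Z : forall m : M, lag E m)
    (W : forall x, lag (LG_bundle E) x) (A : set M) (B : set (LG E)) (x0 : LG E) :
  symplectic_bundle E -> continuous (@LG_proj R M n E) ->
  smooth_section setT X -> smooth_section setT Y ->
  smooth_section A Z -> smooth_section B W -> open A -> open B ->
  (forall m, A m -> transverse (Z m) (X m) /\ transverse (Z m) (Y m)) ->
  (forall x, B x -> transverse (W x) (lifted_section X x) /\
    transverse (W x) (lifted_section Y x)) ->
  A (LG_proj x0) -> B x0 ->
  \forall x \near x0,
    hormander_index (@Defs.form R (LG E) n (LG_bundle E) x)
      (lifted_section X x) (lifted_section Y x) (W x) (lifted_section Z x) =
    hormander_index (@Defs.form R (LG E) n (LG_bundle E) x0)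
      (lifted_section X x0) (lifted_section Y x0) (W x0) (lifted_section Z x0).
Proof.
move=> Es pc Xs Ys Zs Ws oA oB AZ BW Ax0 Bx0.
have ws := fibre_symplectic Es; have to := triv_open Es.
have tc := triv_cover Es; have ti := triv_iso Es.
pose m0 := LG_proj x0.
have pull_basis (C : set M) (S : forall m, lag E m) : smooth_section C S ->
    C m0 -> exists fS : forall x : LG E, 'Hom('rV[R]_n, fib E (LG_proj x)),
    (\forall x \near x0, lker (fS x) == 0%VS /\
      limg (fS x) = lifted_section S x) /\
    forall i, triv_dom i m0 -> forall t b,
      triv i (fS x t) 0 b @[x --> x0] --> triv i (fS x0 t) 0 b.
  move=> Ss Cm0; have [fS [nS cS]] := section_basis ws to tc ti Ss Cm0.
  exists (fun x => fS (LG_proj x)); split; first exact: (pc x0 _ nS).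
  by move=> i im t b; exact: (cvg_comp _ _ (pc x0) (cS i im t b)).
have [fX [nX cX]] := pull_basis _ _ Xs I.
have [fY [nY cY]] := pull_basis _ _ Ys I.
have [fZ [nZ cZ]] := pull_basis _ _ Zs Ax0.
have to' (i : triv_idx (LG_bundle E)) : open (triv_dom i : set (LG E)).
  by move/continuousP: pc; apply; exact: to.
have [fW [nW cW]] := @section_basis R (LG E) n (LG_bundle E)
  (fun x => ws (LG_proj x)) to' (fun x => tc (LG_proj x))
  (fun i x => ti i (LG_proj x)) B W x0 Ws Bx0.
have [i im0] := tc m0.
have pairing (f g : forall x : LG E, 'Hom('rV[R]_n, fib E (LG_proj x))) :
    (forall t b, triv i (f x t) 0 b @[x --> x0] --> triv i (f x0 t) 0 b) ->
    (forall t b, triv i (g x t) 0 b @[x --> x0] --> triv i (g x0 t) 0 b) ->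
    forall s t, Defs.form (f x s) (g x t) @[x --> x0] -->
      Defs.form (f x0 s) (g x0 t).
  move=> fc gc s t.
  exact: (form_cvg to (u := fun x => f x s) (v := fun x => g x t)
    (form_smooth Es i) (pc x0) im0 (fc s) (gc t)).
have nA : \forall x \near x0, A (LG_proj x).
  by apply: (pc x0); exact: open_nbhs_nbhs.
have nB : \forall x \near x0, B x by exact: open_nbhs_nbhs.
apply: (hormander_index_near (fun x => ws (LG_proj x)) _ nX nY nW nZ
  (pairing _ _ (cX i im0) (cY i im0)) (pairing _ _ (cX i im0) (cW i im0))
  (pairing _ _ (cX i im0) (cZ i im0)) (pairing _ _ (cY i im0) (cW i im0))
  (pairing _ _ (cY i im0) (cZ i im0)) (pairing _ _ (cZ i im0) (cW i im0))).
apply: filterS2 nA nB => x /AZ[ZX ZY] /BW[WX WY].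
by split.
Qed.

Theorem theorem1p6 (R : realType) (M : atlas R) (n : nat) (E : bundle M n)
    (X Y : forall m : M, lag E m) :
  smooth_manifold M -> symplectic_bundle E ->
  smooth_section setT X -> smooth_section setT Y ->
  exists pi_continuous : continuous (@LG_proj R M n E),
    forall (s : cechH1 M) (s' : cechH1 (LG E)),
      is_hormander_class X Y s ->
      is_hormander_class (lifted_section X) (lifted_section Y) s' ->
      s' = cech_pull pi_continuous s.
Proof.
move=> _ Es Xs Ys.
have pc := LG_proj_continuous (fibre_symplectic Es) (triv_iso Es) Xs.
exists pc => _ _ [c [Z [_ Zs ZXY cE ->]]] [c' [W [_ Ws WXY c'E ->]]].
rewrite cech_pullE; apply/cech_classP.
exists (cidx c' * cidx c)%type,
  (fun p => cov p.1 `&` @LG_proj R M n E @^-1` cov p.2), fst, snd,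
  (fun p x => hormander_index (@Defs.form R (LG E) n (LG_bundle E) x)
    (lifted_section X x) (lifted_section Y x) (W p.1 x) (Z p.2 (LG_proj x))).
split.
- split=> [[a b]|x].
    apply: openI; first exact: cov_open.
    by move/continuousP: pc; apply; exact: cov_open.
  have [a ax] := cov_cover c' x; have [b bx] := cov_cover c (LG_proj x).
  by exists (a, b).
- by move=> [a b] x.
- move=> [a b] x [/= ax bx].
  exact: (lifted_hormander_index_near Es pc Xs Ys (Zs b) (Ws a) (cov_open b)
    (cov_open a) (ZXY b) (WXY a) bx ax).
- move=> [a b] [a' b'] x [/= ax bx] [/= ax' bx'].
  rewrite (cE b b' _ bx bx') (c'E a a' _ ax ax') /hormander_index.
  rewrite /lifted_section /=.
  (* All terms are differences of the four indices attached to [W a], [W a'], [Z b] and [Z b'] at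
     the same point, and they cancel. *)
  move: (ind _ _ _) (ind _ _ _) (ind _ _ _) (ind _ _ _).
  lia.
Qed.
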